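(* Suppose $n$ is an even integer with $0\leq n<\min\{t_1,t_2,t_3\}$. Then the $\mathfrak{BI}$-module $\mathscr M_n$ is isomorphic to $W\oplus W$, where $W=O_n\big(k_2+k_3+\tfrac{n+1}{2},\,-k_1-k_3-\tfrac{n+1}{2},\,-k_1-k_2-\tfrac{n+1}{2}\big)^{(1,-1)}$. Moreover, if $k_1,k_2,k_3\geq 0$, then $W$ is irreducible and is isomorphic to $O_n\big(k_2+k_3+\tfrac{n+1}{2},\,k_1+k_3+\tfrac{n+1}{2},\,k_1+k_2+\tfrac{n+1}{2}\big)$.
   Context: Fix real numbers $k_1,k_2,k_3$. For $i=1,2,3$ let $R_i$ be the operator on functions on $\mathbb R^3$ replacing $x_i$ by $-x_i$, and let $T_i$ be the Dunkl operator $T_if=\frac{\partial f}{\partial x_i}+k_i\frac{f-R_if}{x_i}$. Let $\sigma_1=\begin{pmatrix}0&1\\1&0\end{pmatrix}$, $\sigma_2=\begin{pmatrix}0&-\sqrt{-1}\\ \sqrt{-1}&0\end{pmatrix}$, $\sigma_3=\begin{pmatrix}1&0\\0&-1\end{pmatrix}$, and let $e_i$ act on $\mathbb C^2$ by $\sigma_i$. Tensor products are over $\mathbb R$; $\mathbb R[x_1,x_2,x_3]_n$ denotes homogeneous polynomials of degree $n$. Let $\mathbf D=e_1\otimes T_1+e_2\otimes T_2+e_3\otimes T_3$ and $\mathscr M_n=\ker(\mathbf D|_{\mathbb C^2\otimes\mathbb R[x_1,x_2,x_3]_n})$. For $i=1,2,3$ set $t_i=-2k_i$ if $2k_i$ is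 an odd negative integer, and $t_i=\infty$ otherwise. The universal Bannai–Ito algebra $\mathfrak{BI}$ is the unital associative $\mathbb C$-algebra generated by $X,Y,Z$ with relations saying that $\kappa=\{X,Y\}-Z$, $\lambda=\{Y,Z\}-X$, $\mu=\{Z,X\}-Y$ commute with $X,Y,Z$ ($\{A,B\}=AB+BA$). $\mathscr M_n$ is a $\mathfrak{BI}$-module via $X=(\sqrt{-1}\,e_1\otimes(x_3T_2-x_2T_3)+\tfrac12)R_2R_3+k_2R_3+k_3R_2$, $Y=(\sqrt{-1}\,e_2\otimes(x_1T_3-x_3T_1)+\tfrac12)R_1R_3+k_3R_1+k_1R_3$, $Z=(\sqrt{-1}\,e_3\otimes(x_2T_1-x_1T_2)+\tfrac12)R_1R_2+k_1R_2+k_2R_1$, operators composed right to left, $R_i$ acting on the polynomial factor. Twisting: for a $\mathfrak{BI}$-module $V$ and an algebra automorphism $\varepsilon$ of $\mathfrak{BI}$, $V^\varepsilon$ is $V$ with new action $x\cdot v=\varepsilon(x)v$. The automorphism $(1,-1)$ is $X\mapsto X$, $Y\mapsto -Y$, $Z\mapsto -Z$. For $a,b,c\in\mathbb C$ and even $d\geq0$, $O_d(a,b,c)$ is the $\mathfrak{BI}$-module $\mathbb C^{d+1}$ in which, w.r.t. a basis $v_0,\dots,v_d$, $X$ acts by the lower bidiagonal matrix with diagonal $(\theta_0,\dots,\theta_d)$ and subdiagonal entries all $1$, $Y$ by the upper bidiagonal matrix with diagonal $(\theta^*_0,\dots,\theta^*_d)$ and superdiagonal $(\varphi_1,\dots,\varphi_d)$,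 and $Z=\{X,Y\}-(2ab-c(d+1))$, where $\theta_i=\frac{(-1)^i(2a-d+2i)}{2}$, $\theta^*_i=\frac{(-1)^i(2b-d+2i)}{2}$, $\varphi_i=\frac{i(d+1-2i-2a-2b-2c)}{2}$ for $i$ even and $\varphi_i=\frac{(i-d-1)(d+1-2i-2a-2b+2c)}{2}$ for $i$ odd. *)

(* Defs.v *)
From HB Require Import structures.
From mathcomp Require Import all_boot all_order all_algebra.
From mathcomp.multinomials Require Import mpoly.
From mathcomp.real_closed Require Import complex.

Set Implicit Arguments.
Unset Strict Implicit.
Unset Printing Implicit Defensive.

Import Order.TTheory GRing.Theory Num.Theory.
Local Open Scope ring_scope.

(* Conventions.
   - The real field is an arbitrary real closed field R (e.g. the reals);
     complex scalars are C := complex R (= R[i]).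
   - Index i : 'I_3 with i = 0,1,2 standing for the paper's 1,2,3.
   - C^2 (x)_R R[x1,x2,x3] is identified with pairs of complex polynomials
     ({mpoly C[3]} * {mpoly C[3]}); R[x]_n  <->  pairs of n.-homog polys. *)

Section Defs.
Variable R : rcfType.
Local Notation C := (complex R).

Definition cR (r : R) : C := Complex r 0.
Definition imC : C := Complex 0 1.

Definition poly3 := {mpoly C[3]}.
Definition spin := (poly3 * poly3)%type.

Definition Refl (i : 'I_3) (p : poly3) : poly3 :=
  p \mPo [tuple (if j == i then - 'X_j else 'X_j : poly3) | j < 3].

(* division by x_i, for a polynomial q all of whose monomials contain x_i
   (this is the case for q = p - R_i p) *)
Definition mdivX (i : 'I_3) (q : poly3) : poly3 :=
  \sum_(m <- msupp q) q@_m *: 'X_[m - U_(i)].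

Definition Dunkl (ki : R) (i : 'I_3) (p : poly3) : poly3 :=
  mderiv i p + cR ki *: mdivX i (p - Refl i p).

Definition pmap (f : poly3 -> poly3) (v : spin) : spin := (f v.1, f v.2).

(* action of e_{i+1} on C^2 by the Pauli matrix sigma_{i+1} *)
Definition sigma (i : 'I_3) (v : spin) : spin :=
  match val i with
  | 0 => (v.2, v.1)
  | 1 => (- imC *: v.2, imC *: v.1)
  | _ => (v.1, - v.2)
  end.

Definition kvec (k1 k2 k3 : R) (i : 'I_3) : R :=
  match val i with 0 => k1 | 1 => k2 | _ => k3 end.

Definition Dirac (k : 'I_3 -> R) (v : spin) : spin :=
  \sum_(i < 3) sigma i (pmap (Dunkl (k i) i) v).

Definition Mspace (k : 'I_3 -> R) (n : nat) (v : spin) : Prop :=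
  v.1 \is n.-homog /\ v.2 \is n.-homog /\ Dirac k v = 0.

Definition BIop (k : 'I_3 -> R) (a b c : 'I_3) (v : spin) : spin :=
  let u := pmap (fun p => Refl b (Refl c p)) v in
  (imC *: sigma a
     (pmap (fun p => 'X_c * Dunkl (k b) b p - 'X_b * Dunkl (k c) c p) u)
   + 2^-1 *: u)
  + cR (k b) *: pmap (Refl c) v + cR (k c) *: pmap (Refl b) v.

Definition BIX (k : 'I_3 -> R) := BIop k 0 1 2.
Definition BIY (k : 'I_3 -> R) := BIop k 1 2 0.
Definition BIZ (k : 'I_3 -> R) := BIop k 2 0 1.

(* t_i condition: n < t_i, where t_i = -2 k_i if 2 k_i is an odd negative
   integer, and t_i = infinity otherwise *)
Definition lt_t (n : nat) (ki : R) : Prop :=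
  (exists m : nat, 2 * ki = - (m.*2.+1)%:R) -> n%:R < - (2 * ki).

(* The module O_d(a,b,c) on C^{d+1} (column vectors, basis v_0..v_d). *)
Definition Otheta (a : C) (d i : nat) : C :=
  (-1) ^+ i * ((2 * a - d%:R + 2 * i%:R) / 2).
Definition Ophi (a b c : C) (d i : nat) : C :=
  if ~~ odd i then (i%:R * (d%:R + 1 - 2 * i%:R - 2 * a - 2 * b - 2 * c)) / 2
  else ((i%:R - d%:R - 1) * (d%:R + 1 - 2 * i%:R - 2 * a - 2 * b + 2 * c)) / 2.

Definition OX (a b c : C) (d : nat) : 'M[C]_d.+1 :=
  \matrix_(i, j) (if i == j then Otheta a d i
                  else if val i == (val j).+1 then 1 else 0).
Definition OY (a b c : C) (d : nat) : 'M[C]_d.+1 :=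
  \matrix_(i, j) (if i == j then Otheta b d i
                  else if val j == (val i).+1 then Ophi a b c d j else 0).
Definition OZ (a b c : C) (d : nat) : 'M[C]_d.+1 :=
  OX a b c d * OY a b c d + OY a b c d * OX a b c d
  - (2 * a * b - c * (d.+1)%:R)%:M.

(* A triple of matrices acting on column vectors of C^{d+1} is an irreducible
   module: the only subspaces invariant under the three actions are 0 and the
   whole space.  A subspace of column vectors is encoded by the row space of U
   (rows = transposed column vectors), so invariance under v |-> A v reads
   (U *m A^T <= U)%MS. *)
Definition mx_irreducible3 (d : nat) (A1 A2 A3 : 'M[C]_d.+1) : Prop :=
  forall U : 'M[C]_d.+1,
    (U *m A1^T <= U)%MS -> (U *m A2^T <= U)%MS -> (U *m A3^T <= U)%MS ->
    U = 0 \/ row_full U.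

Definition mx_iso3 (d : nat) (A1 A2 A3 B1 B2 B3 : 'M[C]_d.+1) : Prop :=
  exists P : 'M[C]_d.+1,
    P \in unitmx /\ P *m A1 = B1 *m P /\ P *m A2 = B2 *m P /\ P *m A3 = B3 *m P.

Definition dsum_space (d : nat) := ('cV[C]_d.+1 * 'cV[C]_d.+1)%type.

Definition dsum_act (d : nat) (A : 'M[C]_d.+1)
  (w : dsum_space d) : dsum_space d :=
  (A *m w.1, A *m w.2).

End Defs.

(* Main.v *)
(* Multiplication by sigma_i composed with the reflection R_i commutes with
   X, Y, Z and anticommutes with the Dirac operator; this is what makes M_n a
   sum of two copies of one module.  An element of M_n is determined by its
   restriction to the plane x_3 = 0 (solve for the x_3-coefficients one at a
   time, which is possible because T_3 does not kill x_3^j for 0 < j <= n), and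
   every pair of n-homogeneous polynomials in x_1, x_2 is such a restriction.
   On the restriction to x_3 = 0 the operators X and Y are bidiagonal in the
   monomials x_1^(n-i) x_2^i, and rescaling these monomials gives exactly the
   matrices of O_n.

   For nonnegative parameters, O_n(a,b,c)^(1,-1) and O_n(a,-b,-c) share the
   matrix of X, so an intertwiner P is a polynomial in X, determined by the
   image of v_0.  Take that image to be the eigenvector of the second Y with
   the right eigenvalue.  The relation obtained by eliminating Z propagates the
   intertwining property from v_0, v_1 to all v_i.  A nonzero submodule U
   contains the X-eigenvector x_0 (as the phi_i are nonzero); every
   coordinate of P x_0 is nonzero, and its last coordinate detects the
   component of x_0 along the Y-eigenvector v_0, which thus lies in U and
   generates everything. *)

Require Import Defs.
From HB Require Import structures.
From mathcomp Require Import all_boot all_order all_algebra.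
From mathcomp.multinomials Require Import mpoly.
From mathcomp.real_closed Require Import complex.
From mathcomp Require Import ring zify.
Import Order.TTheory GRing.Theory Num.Theory.
Local Open Scope ring_scope.

Set Implicit Arguments.
Unset Strict Implicit.
Unset Printing Implicit Defensive.

(** * Coefficients of the Dunkl operators *)

Section MultivariatePolynomials.
Variables (d : nat) (K : comNzRingType).
Implicit Types (p q : {mpoly K[d]}) (m : 'X_{1..d}) (i : 'I_d).

Lemma mcoeff_comp_opp i p m :
  (p \mPo [tuple (if j == i then - 'X_j else 'X_j) | j < d])@_m
  = (-1) ^+ m i * p@_m.
Proof.
rewrite comp_mpolyEX raddf_sum /= [in RHS](mpolyE p) raddf_sum /= mulr_sumr.
apply: eq_bigr => k _; rewrite comp_mpolyX !mcoeffZ mulrCA; congr (_ * _).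
set t := (X in tnth X).
have -> : \prod_(j < d) tnth t j ^+ k j = (-1) ^+ k i *: 'X_[k].
  rewrite mpolyXE_id (bigD1 i) //= [in RHS](bigD1 i) //= tnth_mktuple eqxx.
  rewrite [in LHS]exprNn -[in LHS]signr_odd -[in RHS]signr_odd scaler_sign -mulr_sign -mulrA.
  congr (_ * (_ * _)).
  by apply: eq_bigr => j /negbTE ne; rewrite tnth_mktuple ne.
by rewrite mcoeffZ mcoeffX; case: eqVneq => [->|]; rewrite ?mulr0.
Qed.

(** Truncated subtraction fixes monomials free of x_i, which could then collide with shifted ones;
    the hypothesis on [q] excludes them, and on the remaining monomials the shift is injective. *)
Lemma mcoeff_divX i q m : (forall m', m' i = 0%N -> q@_m' = 0) ->
  (\sum_(m' <- msupp q) q@_m' *: 'X_[m' - U_(i)])@_m = q@_(m + U_(i)).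
Proof.
move=> q0; rewrite raddf_sum /= [in RHS](mpolyE q) raddf_sum /=.
apply: eq_big_seq => k; rewrite mcoeff_msupp => qk.
rewrite !mcoeffZ !mcoeffX; congr (_ * (nat_of_bool _)%:R).
have ki : (0 < k i)%N by rewrite lt0n; apply: contra_neq qk => /q0.
apply/eqP/eqP => [<-|->]; last by rewrite addmK.
by rewrite submK //; apply/mnm_lepP => j; rewrite mnm1E; case: eqVneq => // <-.
Qed.

Lemma mcoeff_XM i p m :
  ('X_i * p)@_m = if m i == 0%N then 0 else p@_(m - U_(i)).
Proof.
case: eqP => [mi|/eqP mi].
  rewrite (mpolyE p) mulr_sumr raddf_sum /= big1 // => k _.
  rewrite -scalerAr mcoeffZ -mpolyXD mcoeffX.
  case: eqP => [e|]; last by rewrite mulr0.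
  by move: mi; rewrite -e mnmDE mnm1E eqxx.
have le : (U_(i) <= m)%MM.
  by apply/mnm_lepP => j; rewrite mnm1E; case: eqVneq => // <-; rewrite lt0n.
by rewrite mulrC -{1}(submK le) addmC mcoeffMX.
Qed.

End MultivariatePolynomials.

Section Coefficients.
Variable R : rcfType.
Local Notation C := (complex R).
Implicit Types (p q : poly3 R) (m : 'X_{1..3}) (i : 'I_3).
Implicit Types (v w : spin R) (F G : nat -> nat -> nat -> C).

Lemma mcoeff_Refl i p m : (Refl i p)@_m = (-1) ^+ m i * p@_m.
Proof. exact: mcoeff_comp_opp. Qed.

(* T_i sends x_i^j to [dunkl_coef k_i j] x_i^(j-1). *)
Definition dunkl_coef (k : R) (j : nat) : C := j%:R + cR k * (1 - (-1) ^+ j).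

Lemma mcoeff_Dunkl (k : R) i p m :
  (Dunkl k i p)@_m = dunkl_coef k (m i).+1 * p@_(m + U_(i)).
Proof.
rewrite /Dunkl mcoeffD mcoeffZ mcoeff_deriv [X in _ * X]mcoeff_divX; last first.
  by move=> m' m'i; rewrite mcoeffB mcoeff_Refl m'i expr0 mul1r subrr.
rewrite mcoeffB mcoeff_Refl mnmDE mnm1E eqxx addn1 -mulr_natl /dunkl_coef.
by ring.
Qed.

Definition mn3 (a b c : nat) : 'X_{1..3} := [multinom [tuple a; b; c]].

Lemma mn3K m : mn3 (m 0) (m 1) (m 2%R) = m.
Proof.
apply/mnmP => i; rewrite multinomE (tnth_nth 0%N).
case: i => [[|[|[|//]]] lt_i3] /=; congr (m _); exact: val_inj.
Qed.

Lemma mn3_eqP m a b c :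
  m 0 = a -> m 1 = b -> m 2%R = c -> m = mn3 a b c.
Proof. by move=> <- <- <-; rewrite mn3K. Qed.

Lemma mdeg_mn3 a b c : mdeg (mn3 a b c) = (a + b + c)%N.
Proof. by rewrite mdegE !big_ord_recr big_ord0 /= add0n. Qed.

Definition coef3 p (a b c : nat) : C := p@_(mn3 a b c).

Lemma coef3P p q : (forall a b c, coef3 p a b c = coef3 q a b c) -> p = q.
Proof. by move=> e; apply/mpolyP => m; rewrite -(mn3K m); apply: e. Qed.

Lemma coef3D p q a b c : coef3 (p + q) a b c = coef3 p a b c + coef3 q a b c.
Proof. exact: mcoeffD. Qed.
Lemma coef3Z z p a b c : coef3 (z *: p) a b c = z * coef3 p a b c.
Proof. exact: mcoeffZ. Qed.
Lemma coef3_Refl0 p a b c : coef3 (Refl 0 p) a b c = (-1) ^+ a * coef3 p a b c.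
Proof. exact: mcoeff_Refl. Qed.
Lemma coef3_Refl1 p a b c : coef3 (Refl 1 p) a b c = (-1) ^+ b * coef3 p a b c.
Proof. exact: mcoeff_Refl. Qed.
Lemma coef3_Refl2 p a b c : coef3 (Refl 2%R p) a b c = (-1) ^+ c * coef3 p a b c.
Proof. exact: mcoeff_Refl. Qed.

Lemma coef3_Dunkl0 k p a b c :
  coef3 (Dunkl k 0 p) a b c = dunkl_coef k a.+1 * coef3 p a.+1 b c.
Proof.
rewrite /coef3 mcoeff_Dunkl; congr (_ * p@_ _); apply: mn3_eqP;
by rewrite mnmDE mnm1E ?addn1 ?addn0.
Qed.
Lemma coef3_Dunkl1 k p a b c :
  coef3 (Dunkl k 1 p) a b c = dunkl_coef k b.+1 * coef3 p a b.+1 c.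
Proof.
rewrite /coef3 mcoeff_Dunkl; congr (_ * p@_ _); apply: mn3_eqP;
by rewrite mnmDE mnm1E ?addn1 ?addn0.
Qed.
Lemma coef3_Dunkl2 k p a b c :
  coef3 (Dunkl k 2%R p) a b c = dunkl_coef k c.+1 * coef3 p a b c.+1.
Proof.
rewrite /coef3 mcoeff_Dunkl; congr (_ * p@_ _); apply: mn3_eqP;
by rewrite mnmDE mnm1E ?addn1 ?addn0.
Qed.

(** The effect of multiplication by a variable on coefficients, with 0 in place of the missing
    exponent -1. It also encodes the subdiagonal of X. *)
Definition predcoef (f : nat -> C) (j : nat) : C :=
  if j is j'.+1 then f j' else 0.

Lemma coef3_XM0 p a b c :
  coef3 ('X_0 * p) a b c = predcoef (fun j => coef3 p j b c) a.
Proof.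
rewrite /coef3 mcoeff_XM; case: a => //= a; congr (p@_ _); apply: mn3_eqP;
by rewrite mnmBE mnm1E ?subn1 ?subn0.
Qed.
Lemma coef3_XM1 p a b c :
  coef3 ('X_1 * p) a b c = predcoef (fun j => coef3 p a j c) b.
Proof.
rewrite /coef3 mcoeff_XM; case: b => //= b; congr (p@_ _); apply: mn3_eqP;
by rewrite mnmBE mnm1E ?subn1 ?subn0.
Qed.
Lemma coef3_XM2 p a b c :
  coef3 ('X_2%R * p) a b c = predcoef (fun j => coef3 p a b j) c.
Proof.
rewrite /coef3 mcoeff_XM; case: c => //= c; congr (p@_ _); apply: mn3_eqP;
by rewrite mnmBE mnm1E ?subn1 ?subn0.
Qed.

Lemma homog_coef3P n p :
  reflect (forall a b c, (a + b + c)%N <> n -> coef3 p a b c = 0)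
          (p \is n.-homog).
Proof.
apply: (iffP idP) => [hp a b c ne|h].
  by apply: (dhomog_nemf_coeff hp); rewrite /= mdeg_mn3; apply/eqP.
apply/dhomogP => m; rewrite mcoeff_msupp; apply: contra_neq_eq.
rewrite /= -(mn3K m) mdeg_mn3 => /eqP; exact: h.
Qed.

Definition poly_of_coefs n (F : nat -> nat -> nat -> C) : poly3 R :=
  \sum_(m : 'X_{1..3 < n.+1}) (F (m 0) (m 1) (m 2%R) *: 'X_[m]).

Lemma coef3_poly_of_coefs n F a b c :
  (forall a' b' c', (a' + b' + c')%N <> n -> F a' b' c' = 0) ->
  coef3 (poly_of_coefs n F) a b c = F a b c.
Proof.
move=> F0; rewrite /coef3 /poly_of_coefs.
have [lt_n|ge_n] := ltnP (a + b + c)%N n.+1.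
  by rewrite (mcoeff_mpoly (fun m => F (m 0) (m 1) (m 2%R))) ?mdeg_mn3.
rewrite F0 => [|e]; last by rewrite e ltnn in ge_n.
rewrite raddf_sum big1 //= => m _; rewrite mcoeffZ mcoeffX.
case: eqP => [e|]; last by rewrite mulr0.
by have := bmdeg m; rewrite e mdeg_mn3 ltnNge ge_n.
Qed.

Lemma spinP v w : (forall a b c, coef3 v.1 a b c = coef3 w.1 a b c) ->
  (forall a b c, coef3 v.2 a b c = coef3 w.2 a b c) -> v = w.
Proof.
by case: v w => [v1 v2] [w1 w2] /= e1 e2; congr pair; apply: coef3P.
Qed.

Lemma imCK : imC R * imC R = -1.
Proof. by apply/eqP; rewrite eq_complex /=; apply/andP; split; apply/eqP; ring. Qed.

Lemma cRD (x y : R) : cR (x + y) = cR x + cR y.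
Proof. exact: (rmorphD (real_complex R)). Qed.

Lemma signS j : (-1) ^+ j.+1 = - (-1) ^+ j :> C.
Proof. by rewrite exprS mulN1r. Qed.

Lemma sign_odd_cases j : (odd j = false /\ (-1) ^+ j = 1 :> C) \/
  (odd j = true /\ (-1) ^+ j = -1 :> C).
Proof. by rewrite -signr_odd; case: odd; [right; rewrite expr1 | left; rewrite expr0]. Qed.

(** [F] is meant to be an existential variable, filled in operator by operator by [coefs_step].
    Operator identities thereby become identities between functions of three exponents. *)
Definition has_coefs (p : poly3 R) F := forall a b c, coef3 p a b c = F a b c.

Lemma has_coefs_self p : has_coefs p (coef3 p). Proof. by []. Qed.
Lemma has_coefsD p q F G : has_coefs p F -> has_coefs q G ->
  has_coefs (p + q) (fun a b c => F a b c + G a b c).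
Proof. by move=> hF hG a b c; rewrite -hF -hG; exact: mcoeffD. Qed.
Lemma has_coefsN p F : has_coefs p F -> has_coefs (- p) (fun a b c => - F a b c).
Proof. by move=> hF a b c; rewrite -hF; exact: mcoeffN. Qed.
Lemma has_coefsZ z p F : has_coefs p F ->
  has_coefs (z *: p) (fun a b c => z * F a b c).
Proof. by move=> hF a b c; rewrite -hF; exact: mcoeffZ. Qed.
Lemma has_coefs_Refl0 p F : has_coefs p F ->
  has_coefs (Refl 0 p) (fun a b c => (-1) ^+ a * F a b c).
Proof. by move=> hF a b c; rewrite -hF; exact: coef3_Refl0. Qed.
Lemma has_coefs_Refl1 p F : has_coefs p F ->
  has_coefs (Refl 1 p) (fun a b c => (-1) ^+ b * F a b c).
Proof. by move=> hF a b c; rewrite -hF; exact: coef3_Refl1. Qed.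
Lemma has_coefs_Refl2 p F : has_coefs p F ->
  has_coefs (Refl 2%R p) (fun a b c => (-1) ^+ c * F a b c).
Proof. by move=> hF a b c; rewrite -hF; exact: coef3_Refl2. Qed.
Lemma has_coefs_Dunkl0 (l : R) p F : has_coefs p F ->
  has_coefs (Dunkl l 0 p) (fun a b c => dunkl_coef l a.+1 * F a.+1 b c).
Proof. by move=> hF a b c; rewrite -hF; exact: coef3_Dunkl0. Qed.
Lemma has_coefs_Dunkl1 (l : R) p F : has_coefs p F ->
  has_coefs (Dunkl l 1 p) (fun a b c => dunkl_coef l b.+1 * F a b.+1 c).
Proof. by move=> hF a b c; rewrite -hF; exact: coef3_Dunkl1. Qed.
Lemma has_coefs_Dunkl2 (l : R) p F : has_coefs p F ->
  has_coefs (Dunkl l 2%R p) (fun a b c => dunkl_coef l c.+1 * F a b c.+1).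
Proof. by move=> hF a b c; rewrite -hF; exact: coef3_Dunkl2. Qed.
Lemma has_coefs_XM0 p F : has_coefs p F ->
  has_coefs ('X_0 * p) (fun a b c => predcoef (fun j => F j b c) a).
Proof.
by move=> hF a b c; rewrite [LHS]coef3_XM0; case: a => //= a; rewrite hF.
Qed.
Lemma has_coefs_XM1 p F : has_coefs p F ->
  has_coefs ('X_1 * p) (fun a b c => predcoef (fun j => F a j c) b).
Proof.
by move=> hF a b c; rewrite [LHS]coef3_XM1; case: b => //= b; rewrite hF.
Qed.
Lemma has_coefs_XM2 p F : has_coefs p F ->
  has_coefs ('X_2%R * p) (fun a b c => predcoef (fun j => F a b j) c).
Proof.
by move=> hF a b c; rewrite [LHS]coef3_XM2; case: c => //= c; rewrite hF.
Qed.

Lemma has_coefs_eq p q F G : has_coefs p F -> has_coefs q G ->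
  (forall a b c, F a b c = G a b c) -> p = q.
Proof. by move=> hF hG e; apply: coef3P => a b c; rewrite hF hG. Qed.

Lemma homog_has_coefs n p F : has_coefs p F ->
  (forall a b c, (a + b + c)%N <> n -> F a b c = 0) -> p \is n.-homog.
Proof. by move=> hF F0; apply/homog_coef3P => a b c ?; rewrite hF F0. Qed.

Lemma coef3_eq p F a b c z : has_coefs p F -> F a b c = z -> coef3 p a b c = z.
Proof. by move=> ->. Qed.

End Coefficients.

(* Syntactic dispatch: unification would see [Dunkl] as a sum and match
   [has_coefsD]. *)
Ltac coefs_step :=
  match goal with
  | |- has_coefs (_ + _) _ => eapply has_coefsD
  | |- has_coefs (- _) _ => eapply has_coefsN
  | |- has_coefs (_ *: _) _ => eapply has_coefsZ
  | |- has_coefs (Refl 0 _) _ => eapply has_coefs_Refl0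
  | |- has_coefs (Refl 1 _) _ => eapply has_coefs_Refl1
  | |- has_coefs (Refl 2%R _) _ => eapply has_coefs_Refl2
  | |- has_coefs (Dunkl _ 0 _) _ => eapply has_coefs_Dunkl0
  | |- has_coefs (Dunkl _ 1 _) _ => eapply has_coefs_Dunkl1
  | |- has_coefs (Dunkl _ 2%R _) _ => eapply has_coefs_Dunkl2
  | |- has_coefs ('X_0 * _) _ => eapply has_coefs_XM0
  | |- has_coefs ('X_1 * _) _ => eapply has_coefs_XM1
  | |- has_coefs ('X_2%R * _) _ => eapply has_coefs_XM2
  | |- has_coefs _ _ => eapply has_coefs_self
  end.

Local Opaque Dunkl Refl.

(** * The operators X, Y, Z on the kernel of the Dirac operator *)

Section Operators.
Variable R : rcfType.
Local Notation C := (complex R).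
Variable k : 'I_3 -> R.
Implicit Types (v : spin R).

Lemma DiracE f g : Dirac k (f, g) =
  (Dunkl (k 0) 0 g - imC R *: Dunkl (k 1) 1 g + Dunkl (k 2%R) 2%R f,
   Dunkl (k 0) 0 f + imC R *: Dunkl (k 1) 1 f - Dunkl (k 2%R) 2%R g).
Proof.
rewrite /Dirac !big_ord_recr big_ord0 /= add0r.
have -> : widen_ord (leqnSn 2) (widen_ord (leqnSn 1) ord_max) = 0 by exact: val_inj.
have -> : widen_ord (leqnSn 2) ord_max = 1 by exact: val_inj.
have -> : ord_max = 2%R :> 'I_3 by exact: val_inj.
by congr pair; rewrite /= scaleNr.
Qed.

Lemma BIXE f g : BIX k (f, g) =
  (imC R *: ('X_2%R * Dunkl (k 1) 1 (Refl 1 (Refl 2%R g))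
           - 'X_1 * Dunkl (k 2%R) 2%R (Refl 1 (Refl 2%R g)))
     + 2^-1 *: Refl 1 (Refl 2%R f) + cR (k 1) *: Refl 2%R f
     + cR (k 2%R) *: Refl 1 f,
   imC R *: ('X_2%R * Dunkl (k 1) 1 (Refl 1 (Refl 2%R f))
           - 'X_1 * Dunkl (k 2%R) 2%R (Refl 1 (Refl 2%R f)))
     + 2^-1 *: Refl 1 (Refl 2%R g) + cR (k 1) *: Refl 2%R g
     + cR (k 2%R) *: Refl 1 g).
Proof. by []. Qed.

Lemma BIYE f g : BIY k (f, g) =
  ('X_0 * Dunkl (k 2%R) 2%R (Refl 2%R (Refl 0 g))
           - 'X_2%R * Dunkl (k 0) 0 (Refl 2%R (Refl 0 g))
     + 2^-1 *: Refl 2%R (Refl 0 f) + cR (k 2%R) *: Refl 0 f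
     + cR (k 0) *: Refl 2%R f,
   - ('X_0 * Dunkl (k 2%R) 2%R (Refl 2%R (Refl 0 f))
           - 'X_2%R * Dunkl (k 0) 0 (Refl 2%R (Refl 0 f)))
     + 2^-1 *: Refl 2%R (Refl 0 g) + cR (k 2%R) *: Refl 0 g
     + cR (k 0) *: Refl 2%R g).
Proof.
(* The factor i in Y cancels against the entries -i and i of sigma_2, leaving a sign in the second
   component only. *)
have e1 (p : poly3 R) : imC R *: (- imC R *: p) = p.
  by rewrite scalerA mulrN imCK opprK scale1r.
have e2 (p : poly3 R) : imC R *: (imC R *: p) = - p.
  by rewrite scalerA imCK scaleN1r.
have eqD p q r s t : p = q -> p + r + s + t = q + r + s + t :> poly3 R.
  by move=> ->.
by congr pair; apply: eqD; [apply: e1 | apply: e2].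
Qed.

Lemma BIZE f g : BIZ k (f, g) =
  (imC R *: ('X_1 * Dunkl (k 0) 0 (Refl 0 (Refl 1 f))
           - 'X_0 * Dunkl (k 1) 1 (Refl 0 (Refl 1 f)))
     + 2^-1 *: Refl 0 (Refl 1 f) + cR (k 0) *: Refl 1 f
     + cR (k 1) *: Refl 0 f,
   - imC R *: ('X_1 * Dunkl (k 0) 0 (Refl 0 (Refl 1 g))
           - 'X_0 * Dunkl (k 1) 1 (Refl 0 (Refl 1 g)))
     + 2^-1 *: Refl 0 (Refl 1 g) + cR (k 0) *: Refl 1 g
     + cR (k 1) *: Refl 0 g).
Proof.
have e (p : poly3 R) : imC R *: - p = - imC R *: p by rewrite scalerN scaleNr.
have eqD p q r s t : p = q -> p + r + s + t = q + r + s + t :> poly3 R.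
  by move=> ->.
by apply: (f_equal2 pair (erefl _)); apply: eqD; apply: e.
Qed.

(** Each coefficient identity is split by which exponents vanish, which decides [predcoef], and by
    the parity of the others, which decides every sign. What remains is an algebraic identity modulo
    i^2 = -1. *)
Ltac commute_with_Dirac :=
  let i2 := fresh in have i2 := imCK R;
  congr pair; (eapply has_coefs_eq; [repeat coefs_step | repeat coefs_step | ]);
  rewrite /dunkl_coef;
  move: (coef3 _) (coef3 _) (cR (k 0)) (cR (k 1)) (cR (k 2%R)) => F G k0 k1 k2;
  let i := fresh in move: (imC R) i2 => i i2;
  let a := fresh in let b := fresh in let c := fresh in
  move=> a b c; case: a b c => [|a] [|b] [|c]; cbn [predcoef];
  rewrite ?expr0 ?signS ?expr0;
  try (case: (sign_odd_cases R a) => -[_ ->]); try (case: (sign_odd_cases R b) => -[_ ->]);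
  try (case: (sign_odd_cases R c) => -[_ ->]);
  (by field: i2).

Lemma BIX_Dirac v : Dirac k (BIX k v) = BIX k (Dirac k v).
Proof. case: v => f g; rewrite BIXE !DiracE BIXE; commute_with_Dirac. Qed.

Lemma BIY_Dirac v : Dirac k (BIY k v) = BIY k (Dirac k v).
Proof. case: v => f g; rewrite BIYE !DiracE BIYE; commute_with_Dirac. Qed.

Lemma BIZ_Dirac v : Dirac k (BIZ k v) = BIZ k (Dirac k v).
Proof. case: v => f g; rewrite BIZE !DiracE BIZE; commute_with_Dirac. Qed.

Ltac homogeneous :=
  let hf := fresh in let hg := fresh in
  move=> /homog_coef3P hf /homog_coef3P hg; split => /=;
  (eapply homog_has_coefs; [repeat coefs_step | ]);
  let a := fresh in let b := fresh in let c := fresh in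
  move=> a b c; case: a b c => [|a] [|b] [|c] ?; cbn [predcoef];
  rewrite ?hf ?hg ?mulr0 ?oppr0 ?addr0 ?mulr0 ?oppr0 ?addr0 //; lia.

Lemma BIX_homog n f g : f \is n.-homog -> g \is n.-homog ->
  (BIX k (f, g)).1 \is n.-homog /\ (BIX k (f, g)).2 \is n.-homog.
Proof. rewrite BIXE; homogeneous. Qed.

Lemma BIY_homog n f g : f \is n.-homog -> g \is n.-homog ->
  (BIY k (f, g)).1 \is n.-homog /\ (BIY k (f, g)).2 \is n.-homog.
Proof. rewrite BIYE; homogeneous. Qed.

Lemma BIZ_homog n f g : f \is n.-homog -> g \is n.-homog ->
  (BIZ k (f, g)).1 \is n.-homog /\ (BIZ k (f, g)).2 \is n.-homog.
Proof. rewrite BIZE; homogeneous. Qed.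

Lemma Dirac_coefs f g :
  has_coefs (Dirac k (f, g)).1 (fun a b c =>
    dunkl_coef (k 0) a.+1 * coef3 g a.+1 b c
    - imC R * (dunkl_coef (k 1) b.+1 * coef3 g a b.+1 c)
    + dunkl_coef (k 2%R) c.+1 * coef3 f a b c.+1) /\
  has_coefs (Dirac k (f, g)).2 (fun a b c =>
    dunkl_coef (k 0) a.+1 * coef3 f a.+1 b c
    + imC R * (dunkl_coef (k 1) b.+1 * coef3 f a b.+1 c)
    - dunkl_coef (k 2%R) c.+1 * coef3 g a b c.+1).
Proof. by rewrite DiracE; split=> /=; repeat coefs_step. Qed.

(** Both components are solved for the T_3 term, so that D v = 0 reads as a recursion on the
    exponent of x_3. *)
Lemma Dirac_eq0P f g : Dirac k (f, g) = 0 <->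
  (forall a b c, dunkl_coef (k 2%R) c.+1 * coef3 f a b c.+1 =
     imC R * (dunkl_coef (k 1) b.+1 * coef3 g a b.+1 c)
     - dunkl_coef (k 0) a.+1 * coef3 g a.+1 b c) /\
  (forall a b c, dunkl_coef (k 2%R) c.+1 * coef3 g a b c.+1 =
     dunkl_coef (k 0) a.+1 * coef3 f a.+1 b c
     + imC R * (dunkl_coef (k 1) b.+1 * coef3 f a b.+1 c)).
Proof.
have coef0 a b c : coef3 (0 : poly3 R) a b c = 0 by exact: mcoeff0.
have [h1 h2] := Dirac_coefs f g; split.
  move=> e; have z1 : (Dirac k (f, g)).1 = 0 by rewrite e.
  have z2 : (Dirac k (f, g)).2 = 0 by rewrite e.
  split=> a b c; apply/eqP; rewrite -subr_eq0; apply/eqP.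
    by have := h1 a b c; rewrite z1 coef0 => ->; ring.
  by apply: oppr_inj; have := h2 a b c; rewrite z2 coef0 oppr0 => ->; ring.
move=> [e1 e2]; apply: spinP => a b c.
  by rewrite h1 [RHS]coef0 e1; ring.
by rewrite h2 [RHS]coef0 e2; ring.
Qed.

End Operators.

(** * Extension from the plane x_3 = 0 *)

Section CauchyKovalevskaya.
Variable R : rcfType.
Local Notation C := (complex R).
Variables (k : 'I_3 -> R) (n : nat).
Hypothesis dunkl_neq0 : forall i j, (0 < j <= n)%N -> dunkl_coef (k i) j != 0.

(* The coefficients of x_3^c, from those of x_3^(c-1) by the equation D v = 0. *)
Fixpoint ck (F0 G0 : nat -> nat -> C) (c : nat) :
    (nat -> nat -> C) * (nat -> nat -> C) :=
  if c is c'.+1 then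
    let FG := ck F0 G0 c' in
    (fun a b => (imC R * (dunkl_coef (k 1) b.+1 * FG.2 a b.+1)
                 - dunkl_coef (k 0) a.+1 * FG.2 a.+1 b) / dunkl_coef (k 2%R) c,
     fun a b => (dunkl_coef (k 0) a.+1 * FG.1 a.+1 b
                 + imC R * (dunkl_coef (k 1) b.+1 * FG.1 a b.+1))
                / dunkl_coef (k 2%R) c)
  else (F0, G0).

Definition homog_slice (F : nat -> nat -> C) :=
  forall a b, (a + b)%N <> n -> F a b = 0.

(** Each step raises the exponent of x_3 by one and draws on coefficients with one more x_1 or x_2,
    so the total degree is kept. *)
Lemma ck_homog F0 G0 : homog_slice F0 -> homog_slice G0 ->
  forall c a b, (a + b + c)%N <> n ->
    (ck F0 G0 c).1 a b = 0 /\ (ck F0 G0 c).2 a b = 0.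
Proof.
move=> hF hG; elim=> [|c IH] a b ne /=; first by rewrite hF ?hG //; lia.
have [|-> ->] := IH a.+1 b; first by lia.
have [|-> ->] := IH a b.+1; first by lia.
by rewrite !mulr0 subr0 addr0 mul0r.
Qed.

Definition ck_ext (F0 G0 : nat -> nat -> C) : spin R :=
  (poly_of_coefs n (fun a b c => (ck F0 G0 c).1 a b),
   poly_of_coefs n (fun a b c => (ck F0 G0 c).2 a b)).

Lemma coef3_ck_ext F0 G0 a b c : homog_slice F0 -> homog_slice G0 ->
  coef3 (ck_ext F0 G0).1 a b c = (ck F0 G0 c).1 a b /\
  coef3 (ck_ext F0 G0).2 a b c = (ck F0 G0 c).2 a b.
Proof.
by move=> hF hG; split; apply: coef3_poly_of_coefs => a' b' c' ne;
  have [] := ck_homog hF hG ne.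
Qed.

Lemma ck_ext_Mspace F0 G0 : homog_slice F0 -> homog_slice G0 ->
  Mspace k n (ck_ext F0 G0).
Proof.
move=> hF hG; have x1 a b c := (coef3_ck_ext a b c hF hG).1.
have x2 a b c := (coef3_ck_ext a b c hF hG).2.
split; last split.
- by apply/homog_coef3P => a b c ne; rewrite x1; case: (ck_homog hF hG ne).
- by apply/homog_coef3P => a b c ne; rewrite x2; case: (ck_homog hF hG ne).
move: (ck_ext F0 G0) x1 x2 => [f g] /= x1 x2.
apply/Dirac_eq0P; split=> a b c; rewrite ?x1 ?x2 /=.
  (* For c + 1 > n the divisor may vanish, but all coefficients involved then have degree above n
     and are 0. *)
  have [le|lt] := leqP c.+1 n.
    by rewrite mulrCA divff ?mulr1 // dunkl_neq0.
  have [|_ ->] := ck_homog hF hG (a := a) (b := b.+1) (c := c); first by lia.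
  have [|_ ->] := ck_homog hF hG (a := a.+1) (b := b) (c := c); first by lia.
  by rewrite !mulr0 subrr mul0r mulr0.
have [le|lt] := leqP c.+1 n.
  by rewrite mulrCA divff ?mulr1 // dunkl_neq0.
have [|-> _] := ck_homog hF hG (a := a) (b := b.+1) (c := c); first by lia.
have [|-> _] := ck_homog hF hG (a := a.+1) (b := b) (c := c); first by lia.
by rewrite !mulr0 addr0 mul0r mulr0.
Qed.

Lemma Mspace_slice_inj (v w : spin R) : Mspace k n v -> Mspace k n w ->
  (forall a b, (a + b)%N = n -> coef3 v.1 a b 0 = coef3 w.1 a b 0) ->
  (forall a b, (a + b)%N = n -> coef3 v.2 a b 0 = coef3 w.2 a b 0) -> v = w.
Proof.
case: v w => [f g] [f' g'].
move=> [/= /homog_coef3P hf [/homog_coef3P hg /Dirac_eq0P [e1 e2]]].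
move=> [/= /homog_coef3P hf' [/homog_coef3P hg' /Dirac_eq0P [e1' e2']]] s1 s2.
suff eq c : forall a b, coef3 f a b c = coef3 f' a b c /\ coef3 g a b c = coef3 g' a b c.
  by apply: spinP => a b c /=; case: (eq c a b).
elim: c => [|c IH] a b.
  have [/eqP e|/eqP ne] := boolP ((a + b)%N == n); first by rewrite s1 ?s2.
  by rewrite hf ?hg ?hf' ?hg' //; lia.
have [/eqP e|/eqP ne] := boolP ((a + b + c.+1)%N == n); last first.
  by rewrite hf ?hg ?hf' ?hg' //; lia.
have nz : dunkl_coef (k 2%R) c.+1 != 0 by apply: dunkl_neq0; lia.
have [fa ga] := IH a.+1 b; have [fb gb] := IH a b.+1.
by split; apply: (mulfI nz); rewrite ?e1 ?e1' ?e2 ?e2' ?fa ?fb ?ga ?gb.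
Qed.

End CauchyKovalevskaya.

(** * X, Y, Z in the coordinates of the plane x_3 = 0 *)

Section Sequences.
Variables (R : rcfType) (a b c : complex R) (n : nat).
Local Notation C := (complex R).
Implicit Types (u : nat -> C).

(* The matrices of O_n acting on infinite coordinate sequences; since phi_(n+1)
   vanishes, the coordinates of index > n do not influence the others. *)
Definition seqX u i : C := Otheta a n i * u i + predcoef u i.
Definition seqY u i : C := Otheta b n i * u i + Ophi a b c n i.+1 * u i.+1.
Definition seqZ u i : C :=
  seqX (seqY u) i + seqY (seqX u) i - (2 * a * b - c * n.+1%:R) * u i.

(** Since n + 1 is odd, phi_(n+1) is given by the formula with the factor i - n - 1. *)
Lemma Ophi_last : ~~ odd n -> Ophi a b c n n.+1 = 0.
Proof.
move=> /negbTE n_even; rewrite /Ophi /= n_even /=.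
have -> : n.+1%:R - n%:R - 1 = 0 :> C by ring.
by rewrite !mul0r.
Qed.

End Sequences.

Section Slice.
Variable R : rcfType.
Local Notation C := (complex R).
Variables (k : 'I_3 -> R) (n : nat).
Hypothesis n_even : ~~ odd n.

Local Notation h := (n.+1%:R / 2 : C).
Local Notation ka := (cR (k 1 + k 2%R) + h).
Local Notation kb := (- cR (k 0 + k 2%R) - h).
Local Notation kc := (- cR (k 0 + k 1) - h).

(* v_i = scaling i * x_1^(n-i) x_2^i makes the subdiagonal of X equal to 1. *)
Fixpoint scaling (i : nat) : C :=
  if i is i'.+1 then
    scaling i' * (imC R * (-1) ^+ i' * dunkl_coef (k 0) (n - i')%N)
  else 1.

Lemma scaling_neq0 :
  (forall j, (0 < j <= n)%N -> dunkl_coef (k 0) j != 0) ->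
  forall i, (i <= n)%N -> scaling i != 0.
Proof.
move=> nz; elim=> [|i IH] le; first exact: oner_neq0.
rewrite /= !mulf_neq0 ?signr_eq0 //; first by apply: IH; lia.
  by apply/eqP => i0; have := imCK R; rewrite i0 mul0r => /eqP;
     rewrite eq_sym oppr_eq0 oner_eq0.
by apply: nz; lia.
Qed.

(* The sign in the second component comes from e_1 R_1, which carries the copy of
   W with v.2 = 0 on x_3 = 0 to the one with v.1 = 0 there. *)
Definition slice_coords (v : spin R) (u w : nat -> C) :=
  forall i j, (i + j)%N = n ->
    coef3 v.1 i j 0 = scaling j * u j /\
    coef3 v.2 i j 0 = (-1) ^+ j * (scaling j * w j).

Lemma scalingS i j : (i.+1 + j)%N = n ->
  scaling j.+1 = scaling j * (imC R * (-1) ^+ j * dunkl_coef (k 0) i.+1).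
Proof. by move=> ijn /=; congr (_ * (_ * dunkl_coef _ _)); lia. Qed.

(** Once n is replaced by i + j and the parity of j is fixed, the goal is a field identity in the
    parameters, scalings and coordinates; contradictory cases are left to [lia]. *)
Ltac slice_field j :=
  let i2 := fresh in let e := fresh in let s := fresh in
  have i2 := imCK R;
  cbn [scaling]; rewrite /seqX /seqY /seqZ /Otheta /Ophi /dunkl_coef !cRD /= ?expr0 ?signS;
  (match j with O => idtac | _ =>
     case: (sign_odd_cases R j) => -[e s]; rewrite ?e ?s; cbn [negb] end);
  move: (imC R) i2 => ? i2;
  repeat match goal with
  | |- context [cR ?x] => let y := fresh in move: (cR x) => y
  | |- context [scaling ?x] => let y := fresh in move: (scaling x) => y
  end;
  (first [by field: i2 | exfalso; lia]).

(** On x_3 = 0 the term x_3 T_2 drops out, and D v = 0 trades T_3 in x_2 T_3 for T_1 and T_2. Then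
    x_2 T_2 is diagonal on monomials and x_2 T_1 gives the subdiagonal. *)
Lemma BIX_slice v u w : Mspace k n v -> slice_coords v u w ->
  slice_coords (BIX k v) (seqX ka n u) (seqX ka n w).
Proof.
case: v => f g [_ [_ /Dirac_eq0P [e1 e2]]] s i j ijn.
have s1 i j e := (s i j e).1; have s2 i j e := (s i j e).2.
rewrite {s} /= in s1 s2.
have sign_i : (-1) ^+ i = (-1) ^+ j :> C.
  by rewrite -signr_odd -[RHS]signr_odd; congr (_ ^+ nat_of_bool _); lia.
have mulCC (x y z t : C) : x * (y * (z * t)) = y * z * (x * t) by ring.
rewrite BIXE /=; split; (eapply coef3_eq; [repeat coefs_step|]);
  case: j ijn sign_i => [|j] ijn sign_i; cbn [predcoef];
  rewrite ?mulCC ?e1 ?e2 ?s1 ?s2 ?(@scalingS i j) //; try lia;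
  rewrite -?ijn.
1,3: slice_field 0%N.
all: slice_field j.
Qed.

(** As for X: T_3 is eliminated from x_1 T_3, where x_1 T_1 is diagonal and x_1 T_2 gives the
    superdiagonal. The minus sign is the twist by (1,-1). *)
Lemma BIY_slice v u w : Mspace k n v -> slice_coords v u w ->
  slice_coords (BIY k v) (fun j => - seqY ka kb kc n u j)
    (fun j => - seqY ka kb kc n w j).
Proof.
case: v => f g [_ [_ /Dirac_eq0P [e1 e2]]] s i j ijn.
have s1 i j e := (s i j e).1; have s2 i j e := (s i j e).2.
rewrite {s} /= in s1 s2.
(* As i + j = n is even, R_1 and R_2 act by the same sign on each monomial of the slice. *)
have sign_i : (-1) ^+ i = (-1) ^+ j :> C.
  by rewrite -signr_odd -[RHS]signr_odd; congr (_ ^+ nat_of_bool _); lia.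
have sign_pred i' : i = i'.+1 -> (-1) ^+ i' = - (-1) ^+ j :> C.
  by move=> ei; rewrite -sign_i ei signS opprK.
have scale_Sj i' : i = i'.+1 -> scaling j.+1 =
    scaling j * (imC R * (-1) ^+ j * dunkl_coef (k 0) i'.+1).
  by move=> ?; apply: scalingS; lia.
(* The monomial x_2^n has no successor: multiplication by x_1 contributes nothing at i = 0, matching
   phi_(n+1) = 0. *)
have last : (0 < i)%N || (Ophi ka kb kc n j.+1 == 0).
  case: posnP => //= i0; have -> : j = n by lia.
  by rewrite Ophi_last.
have mulCC (x y z t : C) : x * (y * (z * t)) = y * z * (x * t) by ring.
rewrite BIYE /=; split; (eapply coef3_eq; [repeat coefs_step|]);
  case: i ijn sign_i sign_pred scale_Sj last
    => [|i] ijn sign_i sign_pred scale_Sj last; cbn [predcoef];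
  rewrite ?mulCC ?e1 ?e2 ?s1 ?s2 //; try lia;
  rewrite /seqY; try rewrite (eqP last);
  try rewrite (scale_Sj _ erefl); rewrite /dunkl_coef ?signS;
  try rewrite !(sign_pred _ erefl); rewrite -?ijn.
all: slice_field j.
Qed.

(** Z contains neither x_3 nor T_3, so it acts on the slice directly. It is tridiagonal there: x_2
    T_1 and x_1 T_2 reach the two neighbours of each monomial. *)
Lemma BIZ_slice v u w : slice_coords v u w ->
  slice_coords (BIZ k v) (fun j => - seqZ ka kb kc n u j)
    (fun j => - seqZ ka kb kc n w j).
Proof.
case: v => f g s i j ijn.
have s1 i j e := (s i j e).1; have s2 i j e := (s i j e).2.
rewrite {s} /= in s1 s2.
have sign_i : (-1) ^+ i = (-1) ^+ j :> C.
  by rewrite -signr_odd -[RHS]signr_odd; congr (_ ^+ nat_of_bool _); lia.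
have sign_pred i' : i = i'.+1 -> (-1) ^+ i' = - (-1) ^+ j :> C.
  by move=> ei; rewrite -sign_i ei signS opprK.
have scale_j j' : j = j'.+1 -> scaling j =
    scaling j' * (imC R * (-1) ^+ j' * dunkl_coef (k 0) i.+1).
  by move=> ej; rewrite ej; apply: scalingS; lia.
have scale_Sj i' : i = i'.+1 -> scaling j.+1 =
    scaling j * (imC R * (-1) ^+ j * dunkl_coef (k 0) i'.+1).
  by move=> ?; apply: scalingS; lia.
have last : (0 < i)%N || (Ophi ka kb kc n j.+1 == 0).
  case: posnP => //= i0; have -> : j = n by lia.
  by rewrite Ophi_last.
rewrite BIZE /=; split; (eapply coef3_eq; [repeat coefs_step|]);
  case: i ijn sign_i sign_pred scale_j scale_Sj last
    => [|i] ijn sign_i sign_pred scale_j scale_Sj last; cbn [predcoef];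
  case: j ijn sign_i sign_pred scale_j scale_Sj last
    => [|j] ijn sign_i sign_pred scale_j scale_Sj last; cbn [predcoef];
  rewrite ?s1 ?s2 //; try lia;
  rewrite /seqZ /seqX /seqY; cbn [predcoef]; try rewrite (eqP last);
  try rewrite (scale_Sj _ erefl); try rewrite (scale_j _ erefl); rewrite /dunkl_coef ?signS;
  try rewrite !(sign_pred _ erefl); rewrite ?signS -?ijn.
1,3,5,7: slice_field 0%N.
all: slice_field j.
Qed.

End Slice.

(** * The decomposition of M_n *)

Section OModule.
Variables (R : rcfType) (a b c : complex R) (n : nat).
Local Notation C := (complex R).
Hypothesis n_even : ~~ odd n.
Implicit Types w : 'cV[C]_n.+1.

(** Indices are natural numbers to match the sequence operators. Beyond n, [inord] returns a default
    index, whose coordinate is multiplied by phi_(n+1) = 0 wherever it occurs in Y. *)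
Definition entries w (i : nat) : C := w (inord i) 0.

Lemma entriesP w w' : (forall i, (i <= n)%N -> entries w i = entries w' i) -> w = w'.
Proof.
move=> e; apply/matrixP => i j; rewrite ord1.
by have := e i (ltn_ord i); rewrite /entries inord_val.
Qed.

Lemma entriesD w w' i : entries (w + w') i = entries w i + entries w' i.
Proof. by rewrite /entries mxE. Qed.

Lemma entriesZ z w i : entries (z *: w) i = z * entries w i.
Proof. by rewrite /entries mxE. Qed.

Lemma entriesN w i : entries (- w) i = - entries w i.
Proof. by rewrite /entries mxE. Qed.

Lemma entries_OX w i : (i <= n)%N ->
  entries (OX a b c n *m w) i = seqX a n (entries w) i.
Proof.
move=> le; rewrite /entries mxE (bigD1 (inord i)) //= !mxE eqxx inordK //.
congr (_ + _); case: i le => [|i] le /=.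
  rewrite big1 // => j ne; rewrite mxE eq_sym (negbTE ne) /= inordK //=.
  by rewrite mul0r.
rewrite (bigD1 (inord i)) /=; last first.
  by rewrite -val_eqE /= !inordK; lia.
rewrite mxE -val_eqE /= !inordK; [|lia..].
rewrite gtn_eqF // eqxx mul1r big1 ?addr0 // => j /andP[ne1 ne2].
rewrite mxE eq_sym (negbTE ne1) /= inordK //.
case: eqP => [e|]; last by rewrite mul0r.
by move: ne2; rewrite -val_eqE /= inordK; [case: e => ->; rewrite eqxx|lia].
Qed.

Lemma entries_OY w i : (i <= n)%N ->
  entries (OY a b c n *m w) i = seqY a b c n (entries w) i.
Proof.
move=> le; rewrite /entries mxE (bigD1 (inord i)) //= !mxE eqxx inordK //.
congr (_ + _); have [lt|ge] := ltnP i n; last first.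
  have -> : i = n by lia.
  rewrite Ophi_last // mul0r big1 // => j ne; rewrite mxE eq_sym (negbTE ne) /= inordK; last by lia.
  by rewrite ltn_eqF ?mul0r.
rewrite (bigD1 (inord i.+1)) /=; last first.
  by rewrite -val_eqE /= !inordK; lia.
rewrite mxE -val_eqE /= !inordK; [|lia..].
rewrite ltn_eqF // eqxx big1 ?addr0 // => j /andP[ne1 ne2].
rewrite mxE eq_sym (negbTE ne1) /= inordK //.
case: eqP => [e|]; last by rewrite mul0r.
by move: ne2; rewrite -val_eqE /= inordK; [rewrite e eqxx|lia].
Qed.

Lemma entries_OZ w i : (i <= n)%N ->
  entries (OZ a b c n *m w) i = seqZ a b c n (entries w) i.
Proof.
move=> le; rewrite /OZ mulmxBl mulmxDl mul_scalar_mx -!mulmxA.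
rewrite !entriesD entriesN entriesZ /seqZ entries_OX // entries_OY //.
congr (_ + _ - _).
  rewrite /seqX entries_OY //; congr (_ + _).
  by case: i le => //= i le; rewrite entries_OY // ltnW.
rewrite /seqY entries_OX //; congr (_ + _).
(* At i = n the coordinate n + 1 is out of range, and its factor phi_(n+1) removes it. *)
have [lt|ge] := ltnP i n; first by rewrite entries_OX.
by have -> : i = n; [lia | rewrite Ophi_last // !mul0r].
Qed.

End OModule.

Section Iso.
Variable R : rcfType.
Local Notation C := (complex R).
Variables (k : 'I_3 -> R) (n : nat).

Definition cut_slice (F : nat -> C) (i j : nat) : C :=
  if (i + j == n)%N then F j else 0.

Lemma cut_slice_homog F : homog_slice n (cut_slice F).
Proof. by move=> i j /eqP /negbTE ne; rewrite /cut_slice ne. Qed.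

Definition slice1 (w : dsum_space R n) :=
  cut_slice (fun j => scaling k n j * entries w.1 j).
Definition slice2 (w : dsum_space R n) :=
  cut_slice (fun j => (-1) ^+ j * (scaling k n j * entries w.2 j)).

(** The future isomorphism from W + W to M_n, inverse to reading off scaled coefficients on x_3 =
    0. *)
Definition slice_embed (w : dsum_space R n) : spin R :=
  ck_ext k n (slice1 w) (slice2 w).

Lemma coef3_slice_embed w i j l :
  coef3 (slice_embed w).1 i j l = (ck k (slice1 w) (slice2 w) l).1 i j /\
  coef3 (slice_embed w).2 i j l = (ck k (slice1 w) (slice2 w) l).2 i j.
Proof. by apply: coef3_ck_ext; apply: cut_slice_homog. Qed.

Lemma slice_embed_coords w :
  slice_coords k n (slice_embed w) (entries w.1) (entries w.2).
Proof.
move=> i j ijn; have [-> ->] := coef3_slice_embed w i j 0.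
by rewrite /= /slice1 /slice2 /cut_slice ijn eqxx.
Qed.

(** The linear combination is given by pointwise hypotheses, so that no equality of functions is
    needed. *)
Lemma ck_linear z (F G F' G' F'' G'' : nat -> nat -> C) :
  (forall i j, F'' i j = z * F i j + F' i j) ->
  (forall i j, G'' i j = z * G i j + G' i j) ->
  forall c i j, (ck k F'' G'' c).1 i j = z * (ck k F G c).1 i j + (ck k F' G' c).1 i j
   /\ (ck k F'' G'' c).2 i j = z * (ck k F G c).2 i j + (ck k F' G' c).2 i j.
Proof.
move=> hF hG; elim=> [|c IH] i j; first by rewrite /= hF hG.
cbn [ck fst snd]; have [-> ->] := IH i.+1 j; have [-> ->] := IH i j.+1.
move: (ck _ _ _ _) (ck _ _ _ _) (_^-1) (dunkl_coef _ _) (dunkl_coef _ _) (imC R) => x y t d e i1.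
by split; ring.
Qed.

Lemma slice_embed_linear : linear slice_embed.
Proof.
move=> z x y.
have entriesZD (u v : 'cV[C]_n.+1) i : entries (z *: u + v) i = z * entries u i + entries v i.
  by rewrite /entries !mxE.
have h1 i j : slice1 (z *: x + y) i j = z * slice1 x i j + slice1 y i j.
  rewrite /slice1 /cut_slice; case: eqP => _; last by rewrite mulr0 addr0.
  by rewrite entriesZD mulrDr mulrCA.
have h2 i j : slice2 (z *: x + y) i j = z * slice2 x i j + slice2 y i j.
  rewrite /slice2 /cut_slice; case: eqP => _; last by rewrite mulr0 addr0.
  rewrite entriesZD; move: (entries _ _) (entries _ _) (scaling _ _ _) => p q t.
  by ring.
apply: spinP => i j l; have [e1 e2] := ck_linear h1 h2 l i j.
  rewrite [LHS](coef3_slice_embed _ i j l).1 e1.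
  rewrite -(coef3_slice_embed x i j l).1 -(coef3_slice_embed y i j l).1.
  by rewrite -coef3Z -coef3D.
rewrite [LHS](coef3_slice_embed _ i j l).2 e2.
rewrite -(coef3_slice_embed x i j l).2 -(coef3_slice_embed y i j l).2.
by rewrite -coef3Z -coef3D.
Qed.

Hypothesis n_even : ~~ odd n.
Hypothesis dunkl_neq0 : forall i j, (0 < j <= n)%N -> dunkl_coef (k i) j != 0.

Lemma slice_embed_Mspace w : Mspace k n (slice_embed w).
Proof. by apply: ck_ext_Mspace => //; apply: cut_slice_homog. Qed.

Let scal_neq0 i : (i <= n)%N -> scaling k n i != 0.
Proof. by apply: scaling_neq0 => // j; apply: dunkl_neq0. Qed.

(** Reduces the intertwining identities and surjectivity to computations on the slice. *)
Lemma slice_embed_eq v w : Mspace k n v ->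
  slice_coords k n v (entries w.1) (entries w.2) -> v = slice_embed w.
Proof.
move=> Mv s; apply: (Mspace_slice_inj dunkl_neq0 Mv (slice_embed_Mspace w)) => i j ijn.
  by have [-> _] := s i j ijn; have [-> _] := slice_embed_coords w ijn.
by have [_ ->] := s i j ijn; have [_ ->] := slice_embed_coords w ijn.
Qed.

Lemma slice_coords_ext v u w u' w' :
  (forall i, (i <= n)%N -> u i = u' i) -> (forall i, (i <= n)%N -> w i = w' i) ->
  slice_coords k n v u w -> slice_coords k n v u' w'.
Proof.
move=> eu ew s i j ijn; have [-> ->] := s i j ijn.
by rewrite eu ?ew //; lia.
Qed.

Lemma slice_embed_inj : injective slice_embed.
Proof.
move=> [u w] [u' w'] e.
have s := @slice_embed_coords (u, w); have s' := @slice_embed_coords (u', w').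
rewrite e in s.
congr pair; apply: entriesP => j le.
  apply: (mulfI (scal_neq0 le)).
  by have [<- _] := s _ _ (subnK le); have [<- _] := s' _ _ (subnK le).
have sgn : (-1) ^+ j != 0 :> C by rewrite signr_eq0.
apply: (mulfI (scal_neq0 le)); apply: (mulfI sgn).
by have [_ <-] := s _ _ (subnK le); have [_ <-] := s' _ _ (subnK le).
Qed.

Lemma slice_embed_surj v : Mspace k n v -> exists w, v = slice_embed w.
Proof.
move=> Mv.
(* Dividing the slice coefficients by the nonzero scalings inverts [slice_coords]; the sign in the
   second component is its own inverse. *)
exists (\col_j (coef3 v.1 (n - j) j 0 / scaling k n j),
        \col_j ((-1) ^+ j * coef3 v.2 (n - j) j 0 / scaling k n j)).
apply: slice_embed_eq => // i j ijn; have le : (j <= n)%N by lia.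
have nj : (n - j)%N = i by lia.
rewrite /entries !mxE inordK // nj; split.
  by rewrite mulrC divfK // scal_neq0.
by rewrite [scaling _ _ _ * _]mulrC divfK ?scal_neq0 // mulrA -expr2 sqrr_sign mul1r.
Qed.

Local Notation h := (n.+1%:R / 2 : C).
Local Notation ka := (cR (k 1 + k 2%R) + h).
Local Notation kb := (- cR (k 0 + k 2%R) - h).
Local Notation kc := (- cR (k 0 + k 1) - h).

(** Used to see that X, Y, Z map 0 to 0: they preserve each degree, and 0 is homogeneous of every
    degree. A coefficient of degree d is killed by homogeneity of degree d + 1. *)
Lemma homog_all_eq0 (v : spin R) :
  (forall d, v.1 \is d.-homog /\ v.2 \is d.-homog) -> v = 0.
Proof.
have z0 a b c : coef3 (0 : poly3 R) a b c = 0 by exact: mcoeff0.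
move=> hv; apply: spinP => a b c; rewrite [RHS]z0;
  have [/homog_coef3P h1 /homog_coef3P h2] := hv (a + b + c).+1.
  by apply: h1; lia.
by apply: h2; lia.
Qed.

(** X preserves degrees and commutes with D, so both sides lie in M_n and it suffices to compare
    them on the slice. *)
Lemma slice_embed_BIX w :
  BIX k (slice_embed w) = slice_embed (dsum_act (OX ka kb kc n) w).
Proof.
apply: slice_embed_eq; last first.
  apply: slice_coords_ext (BIX_slice n_even (slice_embed_Mspace w) (slice_embed_coords w)).
    by move=> i le; rewrite entries_OX.
  by move=> i le; rewrite entries_OX.
have [hf [hg e]] := slice_embed_Mspace w; case: (slice_embed w) hf hg e => f g hf hg e.
have [h1 h2] := BIX_homog k hf hg; split; [exact: h1 | split; first exact: h2].
by rewrite BIX_Dirac e; apply: homog_all_eq0 => d; apply: BIX_homog; apply: dhomog0.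
Qed.

Lemma slice_embed_BIY w :
  BIY k (slice_embed w) = slice_embed (dsum_act (- OY ka kb kc n) w).
Proof.
apply: slice_embed_eq; last first.
  apply: slice_coords_ext (BIY_slice n_even (slice_embed_Mspace w) (slice_embed_coords w));
    by move=> i le; rewrite /= mulNmx entriesN entries_OY.
have [hf [hg e]] := slice_embed_Mspace w; case: (slice_embed w) hf hg e => f g hf hg e.
have [h1 h2] := BIY_homog k hf hg; split; [exact: h1 | split; first exact: h2].
by rewrite BIY_Dirac e; apply: homog_all_eq0 => d; apply: BIY_homog; apply: dhomog0.
Qed.

Lemma slice_embed_BIZ w :
  BIZ k (slice_embed w) = slice_embed (dsum_act (- OZ ka kb kc n) w).
Proof.
apply: slice_embed_eq; last first.
  apply: slice_coords_ext (BIZ_slice n_even (slice_embed_coords w));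
    by move=> i le; rewrite /= mulNmx entriesN entries_OZ.
have [hf [hg e]] := slice_embed_Mspace w; case: (slice_embed w) hf hg e => f g hf hg e.
have [h1 h2] := BIZ_homog k hf hg; split; [exact: h1 | split; first exact: h2].
by rewrite BIZ_Dirac e; apply: homog_all_eq0 => d; apply: BIZ_homog; apply: dhomog0.
Qed.

End Iso.

(** * The intertwiner and irreducibility *)

Section Triangular.
Variables (R : rcfType) (a b c : complex R) (n : nat).
Local Notation C := (complex R).

Lemma char_poly_tr (K : fieldType) m (A : 'M[K]_m) : char_poly A^T = char_poly A.
Proof.
rewrite /char_poly -[RHS]det_tr; congr (\det _).
by apply/matrixP => i j; rewrite !mxE eq_sym.
Qed.

(** The first diagonal entry is a simple root; the cofactor [q], evaluated at the matrix, will
    project onto its eigenline up to a nonzero scalar. *)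
Lemma char_poly_split (K : fieldType) m (A : 'M[K]_m.+1) : is_trig_mx A ->
  (forall i, i != 0 -> A i i != A 0 0) ->
  exists2 q : {poly K}, char_poly A = ('X - (A 0 0)%:P) * q & q.[A 0 0] != 0.
Proof.
move=> tr ne; exists (\prod_(i < m.+1 | i != 0) ('X - (A i i)%:P)).
  by rewrite char_poly_trig // (bigD1 0).
rewrite horner_prod; apply/prodf_neq0 => i /ne.
by rewrite hornerXsubC subr_eq0 eq_sym.
Qed.

Lemma OX_diag0 (i : 'I_n.+1) : OX a b c n i i = Otheta a n i.
Proof. by rewrite mxE eqxx. Qed.

Lemma OY_diag0 (i : 'I_n.+1) : OY a b c n i i = Otheta b n i.
Proof. by rewrite mxE eqxx. Qed.

Lemma OX_trig : is_trig_mx (OX a b c n).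
Proof.
apply/is_trig_mxP => i j lt; rewrite mxE -val_eqE /= (ltn_eqF lt).
by case: eqP => // e; rewrite e ltnNge leqnSn in lt.
Qed.

Lemma OY_trig : is_trig_mx (OY a b c n)^T.
Proof.
apply/is_trig_mxP => i j lt; rewrite !mxE -val_eqE /= (gtn_eqF lt).
by case: eqP => // e; rewrite e ltnNge leqnSn in lt.
Qed.

End Triangular.

Section SequencesRelation.
Variables (R : rcfType).
Local Notation C := (complex R).
Variables (a b c : C) (n : nat).

(* The relation ZX + XZ = Y + mu after substituting Z = XY + YX - kappa. *)
Lemma seq_relation u i :
  seqX a n (seqX a n (seqY a b c n u)) i + 2 * seqX a n (seqY a b c n (seqX a n u)) i
  + seqY a b c n (seqX a n (seqX a n u)) i - seqY a b c n u i
  = 2 * (2 * a * b - c * n.+1%:R) * seqX a n u i + (2 * c * a - b * n.+1%:R) * u i.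
Proof.
rewrite /seqX /seqY /predcoef.
case: i => [|[|i]]; rewrite /Otheta /Ophi /= ?signS ?expr0.
- by move: (u 0%N) (u 1%N) => x y; field.
- by move: (u 0%N) (u 1%N) (u 2%N) => x y z; field.
move: (u i) (u i.+1) (u i.+2) (u i.+3) => x y z t.
by case: (sign_odd_cases R i) => -[-> ->]; rewrite /=; field.
Qed.
End SequencesRelation.

Section Eigen.
Variables (K : fieldType) (m : nat).
Implicit Types (B U : 'M[K]_m.+1).

Lemma horner_mx_eigen B (rho : 'cV[K]_m.+1) t p : B *m rho = t *: rho ->
  horner_mx B p *m rho = p.[t] *: rho.
Proof.
move=> e; elim/poly_ind: p => [|p z IH]; first by rewrite rmorph0 mul0mx horner0 scale0r.
rewrite rmorphD rmorphM /= horner_mx_X horner_mx_C mulmxDl -mulmxA e -scalemxAr IH.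
by rewrite mul_scalar_mx hornerMXaddC scalerDl scalerA mulrC.
Qed.

(** Take u' = u q(B). It stays in U, Cayley-Hamilton makes it an eigenvector, and pairing with [rho]
    multiplies u rho by q(t), so it is nonzero. *)
Lemma stable_eigenvector B U t (q : {poly K}) (u : 'rV[K]_m.+1) (rho : 'cV[K]_m.+1) :
  (U *m B <= U)%MS -> char_poly B = ('X - t%:P) * q -> q.[t] != 0 ->
  B *m rho = t *: rho -> (u <= U)%MS -> u *m rho != 0 ->
  exists u' : 'rV[K]_m.+1, [/\ (u' <= U)%MS, u' *m B = t *: u' & u' *m rho != 0].
Proof.
move=> stU cp qt e uU nz; exists (u *m horner_mx B q); split.
- exact: submx_trans (submxMr _ uU) (horner_mx_stable _ stU).
- have := Cayley_Hamilton B; rewrite cp mulrC rmorphM rmorphB /= horner_mx_X horner_mx_C.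
  move=> h0; apply/eqP; rewrite -subr_eq0 -mul_mx_scalar -mulmxBr -mulmxA.
  by rewrite [_ *m (B - _)]h0 mulmx0.
- by rewrite -mulmxA (horner_mx_eigen _ e) -scalemxAr scaler_eq0 negb_or qt.
Qed.

End Eigen.

Local Opaque OX OY.

Section Intertwiner.
Variables (R : rcfType) (a b c : complex R) (n : nat).
Local Notation C := (complex R).
Hypothesis n_even : ~~ odd n.
Local Notation X := (OX a b c n).
Local Notation Y1 := (OY a b c n).
Local Notation Y2 := (OY a (- b) (- c) n).
Implicit Types w : 'cV[C]_n.+1.

Definition has_entries w (u : nat -> C) := forall i, (i <= n)%N -> entries w i = u i.

Lemma has_entries_OX b' c' w u : has_entries w u ->
  has_entries (OX a b' c' n *m w) (seqX a n u).
Proof.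
move=> hu i le; rewrite entries_OX // /seqX hu //; congr (_ + _).
by case: i le => //= i le; rewrite hu // ltnW.
Qed.

Lemma has_entries_OY b' c' w u : has_entries w u ->
  has_entries (OY a b' c' n *m w) (seqY a b' c' n u).
Proof.
move=> hu i le; rewrite entries_OY // /seqY hu //; congr (_ + _).
have [lt|ge] := ltnP i n; first by rewrite hu.
by have -> : i = n; [lia | rewrite Ophi_last // !mul0r].
Qed.

(** The left side is linear in Y and the right side is odd in (b', c'), so [Y1] and -[Y2] satisfy
    the same relation with X. *)
Lemma OX_OY_relation b' c' w : let Y := OY a b' c' n in
  X *m (X *m (Y *m w)) + 2 *: (X *m (Y *m (X *m w))) + Y *m (X *m (X *m w)) - Y *m w
  = (2 * (2 * a * b' - c' * n.+1%:R)) *: (X *m w) + (2 * c' * a - b' * n.+1%:R) *: w.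
Proof.
move=> Y; have hOX := @has_entries_OX b c; have hOY := @has_entries_OY b' c'.
rewrite -/Y in hOY; clearbody Y; move: X hOX => X0 hOX.
apply: (@entriesP _ n) => i le.
have hw : has_entries w (entries w) by [].
have hX := hOX _ _ hw; have hY := hOY _ _ hw.
rewrite !entriesD entriesN !entriesZ (hOX _ _ (hOX _ _ hY) i le) (hOX _ _ (hOY _ _ hX) i le).
rewrite (hOY _ _ (hOX _ _ hX) i le) (hY i le) (hX i le).
exact: seq_relation.
Qed.

Definition evec (j : nat) : 'cV[C]_n.+1 := delta_mx (inord j) 0.

Lemma entries_evec j i : (j <= n)%N -> (i <= n)%N -> entries (evec j) i = (i == j)%:R.
Proof.
move=> lej lei; rewrite /entries /evec mxE eqxx andbT -val_eqE /= !inordK //.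
Qed.

Lemma mulmx_evec (A : 'M[C]_n.+1) j : (j <= n)%N -> A *m evec j = col (inord j) A.
Proof. by move=> le; rewrite /evec colE. Qed.

Lemma evec_ext (A B : 'M[C]_n.+1) :
  (forall j, (j <= n)%N -> A *m evec j = B *m evec j) -> A = B.
Proof.
move=> e; apply/matrixP => i j.
have := e j (ltn_ord j); rewrite !mulmx_evec ?inord_val; [|by rewrite -ltnS ltn_ord..].
by move/colP/(_ i); rewrite !mxE.
Qed.

Lemma OX_evec b' c' j : (j < n)%N ->
  evec j.+1 = OX a b' c' n *m evec j - Otheta a n j *: evec j.
Proof.
move=> lt; apply: (@entriesP _ n) => i le.
rewrite entriesD entriesN entriesZ entries_OX // /seqX !entries_evec ?(ltnW lt) //.
have -> : predcoef (entries (evec j)) i = (i == j.+1)%:R.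
  by case: i le => //= i le; rewrite entries_evec // ltnW.
by case: (eqVneq i j) => [->|_]; rewrite ?mulr1 ?mulr0; ring.
Qed.

Lemma OY_evec0 b' c' : OY a b' c' n *m evec 0 = Otheta b' n 0 *: evec 0.
Proof.
apply: (@entriesP _ n) => i le.
rewrite entriesZ entries_OY // /seqY.
have [lt|ge] := ltnP i n; last first.
  have -> : i = n by lia.
  rewrite Ophi_last // mul0r addr0 !entries_evec //.
  by case: (eqVneq n 0%N) => [->|_]; rewrite ?mulr0.
rewrite !entries_evec //=.
by case: (eqVneq i 0%N) => [->|_]; rewrite ?mulr0 addr0.
Qed.

Lemma OY_evec1 b' c' : (0 < n)%N ->
  OY a b' c' n *m evec 1 = Otheta b' n 1 *: evec 1 + Ophi a b' c' n 1 *: evec 0.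
Proof.
move=> n0; apply: (@entriesP _ n) => i le.
rewrite entriesD !entriesZ entries_OY // /seqY.
have [lt|ge] := ltnP i n; last first.
  have -> : i = n by lia.
  rewrite Ophi_last // mul0r addr0 !entries_evec //.
  rewrite (gtn_eqF n0) mulr0 addr0.
  by case: (eqVneq n 1%N) => [->|_]; rewrite ?mulr0.
rewrite !entries_evec //= eqSS.
by case: i le lt => [|[|i]] /= le lt; rewrite ?mulr0 ?mulr1 ?addr0 ?add0r.
Qed.

(** The Newton polynomials, products of X - theta_i over i < j; they carry the cyclic vector v_0 to
    v_j. *)
Fixpoint newton (j : nat) : 'M[C]_n.+1 :=
  if j is j'.+1 then (X - (Otheta a n j')%:M) *m newton j' else 1%:M.

Lemma newton_comm j : X *m newton j = newton j *m X.
Proof.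
elim: j => [|j IH] /=; first by rewrite mulmx1 mul1mx.
rewrite -mulmxA -IH !mulmxA; congr (_ *m _).
by rewrite mulmxBl mulmxBr scalar_mxC.
Qed.

Lemma newton_evec j : (j <= n)%N -> newton j *m evec 0 = evec j.
Proof.
elim: j => [|j IH] le /=; first by rewrite mul1mx.
rewrite -mulmxA IH; last exact: ltnW.
by rewrite mulmxBl mul_scalar_mx (OX_evec b c le).
Qed.

(** Any prescribed image y of v_0 is reached by the polynomial in X whose Newton coefficients are
    the coordinates of y. *)
Lemma comm_OX_exists (y : 'cV[C]_n.+1) :
  exists P : 'M[C]_n.+1, P *m X = X *m P /\ P *m evec 0 = y.
Proof.
exists (\sum_(j < n.+1) y j 0 *: newton j); split.
  rewrite mulmx_suml mulmx_sumr; apply: eq_bigr => j _.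
  by rewrite -scalemxAl -scalemxAr newton_comm.
rewrite mulmx_suml [RHS]matrix_sum_delta; apply: eq_bigr => j _.
by rewrite big_ord1 -scalemxAl newton_evec ?/evec ?inord_val // -ltnS ltn_ord.
Qed.

End Intertwiner.

Arguments evec {R n} j.

(** * The intertwiner between Y1 and -Y2 *)

Section Flip.
Variables (R : rcfType) (a b c : complex R) (n : nat).
Local Notation C := (complex R).
Hypothesis n_even : ~~ odd n.
Local Notation X := (OX a b c n).
Local Notation Y1 := (OY a b c n).
Local Notation Y2 := (OY a (- b) (- c) n).
Local Notation E := (Otheta (- b) n n).
Hypothesis phi'_neq0 : forall i, (0 < i <= n)%N -> Ophi a (- b) (- c) n i != 0.

(** Solves [Y2] y = [E] y from the top coordinate y_0 = 1 downwards. *)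
Fixpoint flip_coef (i : nat) : C :=
  if i is j.+1 then
    flip_coef j * (E - Otheta (- b) n j) / Ophi a (- b) (- c) n i
  else 1.

(** Y1 v_0 is the first diagonal entry of Y1 times v_0, so [Y2] P = - P [Y1] forces P v_0 into the
    [E]-eigenspace of [Y2]. *)
Lemma Otheta_opp0 : E = - Otheta b n 0.
Proof. by rewrite /Otheta -signr_odd (negbTE n_even) !expr0; field. Qed.

(** At i = n the recursion closes up: phi_(n+1) = 0 and [E] is the last diagonal entry of [Y2]. *)
Lemma Ophi_flip_coefS i : (i <= n)%N ->
  Ophi a (- b) (- c) n i.+1 * flip_coef i.+1 = (E - Otheta (- b) n i) * flip_coef i.
Proof.
rewrite leq_eqVlt => /orP[/eqP -> | lt]; first by rewrite Ophi_last // subrr !mul0r.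
by rewrite [flip_coef _.+1]/= mulrCA divff ?phi'_neq0 // mulr1 mulrC.
Qed.

Definition flip_vec : 'cV[C]_n.+1 := \col_i flip_coef i.

Lemma entries_flip_vec : has_entries flip_vec flip_coef.
Proof. by move=> i le; rewrite /entries mxE inordK. Qed.

Lemma OY_flip_vec : Y2 *m flip_vec = E *: flip_vec.
Proof.
apply: (@entriesP _ n) => i le.
rewrite (has_entries_OY a n_even (- b) (- c) entries_flip_vec le).
rewrite [RHS]/entries mxE -/(entries flip_vec i) entries_flip_vec // /seqY.
by rewrite Ophi_flip_coefS //; ring.
Qed.

(** The right side is - P Y1 X v_0, computed from X v_0 = v_1 + theta_0 v_0 and the action of Y1 on
    v_0 and v_1. It is the second initial condition for the induction in [flip_exists]. *)
Lemma OYX_flip_vec : (0 < n)%N -> Y2 *m (X *m flip_vec) =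
  - Otheta b n 1 *: (X *m flip_vec)
  - (Otheta a n 0 * Otheta b n 0 - Otheta a n 0 * Otheta b n 1 + Ophi a b c n 1)
    *: flip_vec.
Proof.
move=> n0; apply: (@entriesP _ n) => i le.
have hX := has_entries_OX a n_even b c entries_flip_vec.
rewrite (has_entries_OY a n_even (- b) (- c) hX le).
rewrite entriesD entriesN !entriesZ (hX i le) (entries_flip_vec le) /seqY.
have -> : seqX a n flip_coef i.+1 = Otheta a n i.+1 * flip_coef i.+1 + flip_coef i by [].
rewrite [Ophi _ _ _ _ _ * (_ + _)]mulrDr [Ophi _ _ _ _ _ * (_ * _)]mulrCA Ophi_flip_coefS // /seqX.
have En : E = (2 * - b + n%:R) / 2.
  by rewrite Otheta_opp0 /Otheta expr0; field.
rewrite En.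
case: i le {hX} => [|i] le; rewrite [predcoef _ _]/=.
  by rewrite /Otheta /Ophi /= ?signS ?expr0; field.
have := @Ophi_flip_coefS i (ltnW le).
rewrite En.
move: (flip_coef i) (flip_coef i.+1) => x y.
rewrite /Otheta /Ophi /= ?signS ?expr0.
have ni : (n%:R - i%:R) != 0 :> C.
  by rewrite -natrB ?(ltnW le) // pnatr_eq0 subn_eq0 -ltnNge.
case: (sign_odd_cases R i) => -[-> ->]; rewrite /= => h.
  (* For even i both sides of [h] contain the factor n - i; cancelling it expresses y_i through
     y_(i+1). *)
  have -> : x = - y * (n%:R + 1 - 2 * i.+1%:R - 2 * a - 2 * - b + 2 * - c) / 2.
    apply: (mulfI ni).
    transitivity (((2 * - b + n%:R) / 2 - 1 * ((2 * - b - n%:R + 2 * i%:R) / 2)) * x).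
      by field.
    by rewrite -h; field.
  by field.
(* For odd i the claim is [h] itself up to sign. *)
move/eqP: h; rewrite -subr_eq0 => /eqP h; apply/eqP; rewrite -subr_eq0; apply/eqP.
by rewrite -[RHS]oppr0 -[in RHS]h; field.
Qed.

Lemma flip_exists : exists P : 'M[C]_n.+1,
  [/\ P *m X = X *m P, Y2 *m P = - (P *m Y1) & P *m evec 0 = flip_vec].
Proof.
have [P [PX Pe]] := comm_OX_exists a b c n_even flip_vec.
exists P; split=> //.
have rel1 := OX_OY_relation a b c n_even b c.
have rel2 := OX_OY_relation a b c n_even (- b) (- c).
cbv zeta in rel1, rel2.
have X_evec j : (j < n)%N -> X *m evec j = evec j.+1 + Otheta a n j *: evec j.
  by move=> lt; rewrite (OX_evec a n_even b c lt) subrK.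
have Y1e0 := OY_evec0 a n_even b c; have Y1e1 := OY_evec1 a n_even b c.
have Y2y := OY_flip_vec; have Y2Xy := OYX_flip_vec.
move: X Y1 Y2 flip_vec PX Pe rel1 rel2 X_evec Y1e0 Y1e1 Y2y Y2Xy.
rewrite Otheta_opp0 => X0 Y Y' y PX Pe rel1 rel2 X_evec Y1e0 Y1e1 Y2y Y2Xy.
(* [D] measures the failure of the intertwining relation at [w]. *)
pose D (w : 'cV[C]_n.+1) := Y' *m (P *m w) + P *m (Y *m w).
have DD u v : D (u + v) = D u + D v by rewrite /D !mulmxDr addrACA.
have DZ z u : D (z *: u) = z *: D u by rewrite /D -!scalemxAr scalerDr.
have PXw w : P *m (X0 *m w) = X0 *m (P *m w) by rewrite !mulmxA PX.
(* Add P times the relation for Y1 at w to the relation for Y2 at P w. The right sides cancel,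
   leaving X^2 D(w) + 2 X D(X w) + D(X^2 w) - D(w) = 0. *)
have step w : D w = 0 -> D (X0 *m w) = 0 -> D (X0 *m (X0 *m w)) = 0.
  rewrite /D => /eqP; rewrite addr_eq0 => /eqP Dw /eqP; rewrite addr_eq0 => /eqP DXw.
  have r1 := congr1 (mulmx P) (rel1 w); have r2 := rel2 (P *m w).
  rewrite -!PXw Dw DXw in r2.
  rewrite !mulmxBr !mulmxDr -!scalemxAr !PXw in r1.
  rewrite !PXw in r2; rewrite !mulmxN scalerN in r2; rewrite /D !PXw.
  move: (P *m w) (X0 *m (P *m w)) (P *m (Y *m w))
    (Y' *m (X0 *m (X0 *m (P *m w)))) (P *m (Y *m (X0 *m (X0 *m w))))
    (X0 *m (P *m (Y *m (X0 *m w)))) (X0 *m (X0 *m (P *m (Y *m w)))) r1 r2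
    => Q W V T S B A r1 r2.
  apply/matrixP => i j; move/matrixP/(_ i j): r1; move/matrixP/(_ i j): r2.
  rewrite !mxE; move: (A i j) (B i j) (S i j) (T i j) (V i j) (W i j) (Q i j).
  move=> xA xB xS xT xV xW xQ /eqP; rewrite -subr_eq0 => /eqP e2 /eqP.
  rewrite -subr_eq0 => /eqP e1; transitivity (0 + 0 : C); last exact: addr0.
  by rewrite -{1}e1 -e2; ring.
have D0 : D (evec 0) = 0.
  by rewrite /D Y1e0 Pe -scalemxAr Pe Y2y scaleNr addNr.
apply: evec_ext => j le; apply/eqP; rewrite mulNmx -addr_eq0 -!mulmxA; apply/eqP.
case: (posnP n) => [n0 | n0]; first by have -> : j = 0%N; [lia | exact: D0].
have DX0 : D (X0 *m evec 0) = 0.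
  have Pe1 : P *m evec 1 = X0 *m y - Otheta a n 0 *: y.
    by rewrite -Pe -PXw X_evec // mulmxDr -scalemxAr addrK.
  rewrite /D PXw Pe (Y2Xy n0) X_evec // mulmxDr (Y1e1 n0) -!scalemxAr Y1e0.
  rewrite !mulmxDr -!scalemxAr Pe1 Pe.
  move: (X0 *m y) => z; apply/matrixP => i l; rewrite !mxE.
  move: (z i l) (y i l) => p q.
  by ring.
(* The recursion has order two, so the induction carries two consecutive conditions. *)
suff h : D (evec j) = 0 /\ D (X0 *m evec j) = 0 by exact: h.1.
elim: j le => [|j IH] lt; first by [].
have [h1 h2] := IH (ltnW lt).
have ej : evec j.+1 = X0 *m evec j + (- Otheta a n j) *: evec j.
  by rewrite X_evec // scaleNr addrK.
rewrite ej mulmxDr -scalemxAr !DD !DZ h1 h2 (step _ h1 h2).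
by rewrite !scaler0 !addr0.
Qed.

End Flip.

(** * Submodules when the phi_i are nonzero and the first eigenvalues simple *)

Section Irreducible.
Variables (R : rcfType) (a b c : complex R) (n : nat).
Local Notation C := (complex R).
Hypothesis n_even : ~~ odd n.
Local Notation X := (OX a b c n).
Local Notation Y1 := (OY a b c n).
Local Notation Y2 := (OY a (- b) (- c) n).
Local Notation E := (Otheta (- b) n n).
Hypothesis phi_neq0 : forall i, (0 < i <= n)%N -> Ophi a b c n i != 0.
Hypothesis phi'_neq0 : forall i, (0 < i <= n)%N -> Ophi a (- b) (- c) n i != 0.
Hypothesis theta_inj0 : forall i, (0 < i <= n)%N -> Otheta a n i != Otheta a n 0.
Hypothesis theta'_inj0 : forall i, (0 < i <= n)%N -> Otheta b n i != Otheta b n 0.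

(** The subdiagonal entries are 1, so a zero coordinate i + 1 of an eigenvector forces a zero
    coordinate i. *)
Lemma OX_eigen_entries_neq0 w : X *m w = Otheta a n 0 *: w -> entries w 0 != 0 ->
  forall i, (i <= n)%N -> entries w i != 0.
Proof.
move=> e w0; elim=> [|i IH] // lt.
have := congr1 (fun v => entries v i.+1) e; rewrite entries_OX // /seqX /=.
have -> : entries (Otheta a n 0 *: w) i.+1 = Otheta a n 0 * entries w i.+1.
  by rewrite /entries mxE.
move=> h; apply/eqP => w1; move: h; rewrite w1 !mulr0 add0r => h.
by move: (IH (ltnW lt)); rewrite h eqxx.
Qed.

(** The coordinates of positive index vanish one after another, starting from the last, since their
    diagonal entries differ from the first. *)
Lemma OY_eigen_evec0 w : Y1 *m w = Otheta b n 0 *: w ->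
  w = entries w 0 *: evec 0.
Proof.
move=> e.
have rec i : (0 < i <= n)%N -> (forall j, j = i.+1 -> (j <= n)%N -> entries w j = 0) -> entries w i = 0.
  move=> /andP[i0 le] hj.
  have := congr1 (fun v => entries v i) e; rewrite entries_OY // /seqY entriesZ.
  have -> : Ophi a b c n i.+1 * entries w i.+1 = 0.
    have [lt|ge] := ltnP i n; first by rewrite (hj i.+1) ?mulr0.
    by have -> : i = n; [lia | rewrite Ophi_last // mul0r].
  rewrite addr0 => /eqP; rewrite -subr_eq0 -mulrBl mulf_eq0 subr_eq0.
  by rewrite (negbTE (theta'_inj0 _)) ?i0 // => /eqP.
have all0 d : forall i, (0 < i <= n)%N -> (n - i <= d)%N -> entries w i = 0.
  elim: d => [|d IH] i hi hd; apply: rec => // j -> le; first by lia.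
  by apply: IH; lia.
apply: (@entriesP _ n) => i le; rewrite entriesZ entries_evec //.
by case: i le => [|i] le; rewrite ?mulr1 // mulr0; apply: (all0 n); lia.
Qed.

(** The first row of P vanishes off the diagonal: P v_(j+1) = (X - theta_j) P v_j has coordinate 0
    equal to theta_0 - theta_j times that of P v_j. *)
Lemma comm_OX_entries0 (P : 'M[C]_n.+1) w : P *m X = X *m P ->
  entries (P *m w) 0 = entries (P *m evec 0) 0 * entries w 0.
Proof.
move=> PX.
have h j : (j <= n)%N -> entries (P *m evec j) 0 = (j == 0%N)%:R * entries (P *m evec 0) 0.
  elim: j => [|j IH] lt; first by rewrite mul1r.
  have le := ltnW lt; rewrite (OX_evec a n_even b c lt) mulmxBr -scalemxAr mulmxA PX -mulmxA.
  have -> (x y : 'cV[C]_n.+1) z : entries (x - z *: y) 0 = entries x 0 - z * entries y 0.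
    by rewrite /entries !mxE.
  rewrite entries_OX // /seqX addr0 -mulrBl mul0r IH //.
  by case: (eqVneq j 0%N) => [->|_]; rewrite ?subrr ?mul0r // mulr0.
have ent j : entries (P *m evec j) 0 = P (inord 0) (inord j).
  by rewrite /entries /evec -colE mxE.
rewrite {1}/entries mxE (bigD1 (inord 0)) //= big1 ?addr0 ?ent // => i ne.
have := h i (ltn_ord i); rewrite ent inord_val => ->.
by rewrite -(inj_eq val_inj) /= inordK // in ne; rewrite (negbTE ne) !mul0r.
Qed.

Lemma dot_evec (w : 'cV[C]_n.+1) j : (j <= n)%N -> w^T *m evec j = (entries w j)%:M.
Proof.
move=> le; rewrite /evec -colE; apply/matrixP => i l.
by rewrite !ord1 !mxE.
Qed.

Lemma dot_evec_eq0 (w : 'cV[C]_n.+1) j : (j <= n)%N ->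
  (w^T *m evec j == 0) = (entries w j == 0).
Proof.
move=> le; rewrite dot_evec //; apply/eqP/eqP => [/matrixP/(_ 0 0)|->].
  by rewrite !mxE.
by rewrite raddf0.
Qed.

(** Turns a coordinate form scaled by A into the vector [rho] required by [stable_eigenvector]. *)
Lemma left_eigenvector (A : 'M[C]_n.+1) j t : (j <= n)%N ->
  (forall w : 'cV[C]_n.+1, entries (A *m w) j = t * entries w j) ->
  A^T *m evec j = t *: evec j.
Proof.
move=> le h; apply/matrixP => i l; rewrite ord1 /evec -colE !mxE eqxx andbT.
have ei : (i <= n)%N by rewrite -ltnS ltn_ord.
have := h (evec i); rewrite /entries (mulmx_evec _ ei) inord_val mxE => ->.
by rewrite mxE eqxx andbT inord_val eq_sym.
Qed.

Section Submodule.
Variable U : 'M[C]_n.+1.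
Hypothesis stX : (U *m X^T <= U)%MS.
Hypothesis stY : (U *m Y1^T <= U)%MS.

Lemma sub_OX (w : 'cV[C]_n.+1) : (w^T <= U)%MS -> ((X *m w)^T <= U)%MS.
Proof. by move=> h; rewrite trmx_mul (submx_trans (submxMr _ h)). Qed.

Lemma sub_OY (w : 'cV[C]_n.+1) : (w^T <= U)%MS -> ((Y1 *m w)^T <= U)%MS.
Proof. by move=> h; rewrite trmx_mul (submx_trans (submxMr _ h)). Qed.

(** If coordinate 0 vanished on U, applying Y1 and dividing by the nonzero phi_(i+1) would kill
    coordinates 1, 2, and so on. *)
Lemma stable_entries0 : U != 0 -> exists2 w : 'cV[C]_n.+1, (w^T <= U)%MS & entries w 0 != 0.
Proof.
move=> U0; have [/existsP [r Ur]|] := boolP [exists r, U r 0 != 0].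
  exists (row r U)^T; first by rewrite trmxK row_sub.
  by rewrite /entries !mxE (_ : inord 0 = 0) //; apply: val_inj; rewrite /= inordK.
rewrite negb_exists => /forallP col0; case/eqP: U0.
have hyp i : (i <= n)%N -> forall w : 'cV[C]_n.+1, (w^T <= U)%MS -> entries w i = 0.
  elim: i => [|i IH] le w wU.
    have /submxP [D eD] := wU; rewrite -[w]trmxK eD /entries mxE.
    rewrite (_ : inord 0 = 0); last by apply: val_inj; rewrite /= inordK.
    by rewrite mxE big1 // => j _; move/negPn/eqP: (col0 j) => ->; rewrite mulr0.
  have := IH (ltnW le) _ (sub_OY wU); rewrite entries_OY ?(ltnW le) // /seqY.
  rewrite (IH (ltnW le) w wU) mulr0 add0r => /eqP.
  by rewrite mulf_eq0 (negbTE (phi_neq0 _)) // => /eqP.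
apply/row_matrixP => r; rewrite row0; apply: trmx_inj; rewrite trmx0.
apply: (@entriesP _ n) => i le; rewrite hyp ?trmxK ?row_sub //.
by rewrite /entries mxE.
Qed.

Lemma evec0_sub_full : ((evec 0 : 'cV[C]_n.+1)^T <= U)%MS -> row_full U.
Proof.
move=> h0; rewrite -sub1mx; apply/row_subP => i.
have all_sub j : (j <= n)%N -> ((evec j : 'cV[C]_n.+1)^T <= U)%MS.
  elim: j => [|j IH] le //; rewrite (OX_evec a n_even b c le) linearB linearZ /=.
  have IHj := IH (ltnW le).
  apply: addmx_sub; first exact: sub_OX.
  by rewrite eqmx_opp; exact: scalemx_sub.
have := all_sub i (ltn_ord i); rewrite /evec trmx_delta inord_val.
by rewrite rowE mulmx1.
Qed.

Lemma stable_full : U != 0 -> row_full U.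
Proof.
move=> U0; have [w wU w0] := stable_entries0 U0.
have [q cpX qX] : exists2 q : {poly C}, char_poly X^T = ('X - (Otheta a n 0)%:P) * q &
    q.[Otheta a n 0] != 0.
  have := @char_poly_split _ _ X (OX_trig a b c n); rewrite !OX_diag0 char_poly_tr.
  apply=> i; rewrite -val_eqE /= OX_diag0 => i0; apply: theta_inj0.
  by rewrite lt0n i0 -ltnS ltn_ord.
(* X is lower triangular, so coordinate 0 is an eigenform; pairing with it keeps the projection of w
   nonzero. *)
have rho0 : X^T *m evec 0 = Otheta a n 0 *: evec 0.
  apply: left_eigenvector => // v; rewrite entries_OX // /seqX addr0.
  by [].
have [|u [uU uX u0]] := stable_eigenvector stX cpX qX rho0 wU.
  by rewrite dot_evec_eq0.
have [P [PX PY P0]] := flip_exists n_even phi'_neq0.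
have eX : X *m u^T = Otheta a n 0 *: u^T by rewrite -[X]trmxK -trmx_mul uX linearZ.
have u00 : entries u^T 0 != 0.
  by rewrite -dot_evec_eq0 // trmxK.
have ePX : X *m (P *m u^T) = Otheta a n 0 *: (P *m u^T).
  by rewrite mulmxA -PX -mulmxA eX -scalemxAr.
have Pu0 : entries (P *m u^T) 0 != 0.
  rewrite comm_OX_entries0 // mulf_neq0 // P0 entries_flip_vec //=.
  exact: oner_neq0.
have Pun := OX_eigen_entries_neq0 ePX Pu0 (leqnn n).
have [q' cpY qY] : exists2 q : {poly C}, char_poly Y1^T = ('X - (Otheta b n 0)%:P) * q &
    q.[Otheta b n 0] != 0.
  have := @char_poly_split _ _ Y1^T (OY_trig a b c n).
  rewrite [Y1^T 0 0]mxE !OY_diag0; apply=> i; rewrite -val_eqE /= => i0.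
  rewrite mxE OY_diag0; apply: theta'_inj0.
  by rewrite lt0n i0 -ltnS ltn_ord.
(* The last coordinate is an eigenform of [Y2] with eigenvalue [E]. Composed with P it becomes one
   of [Y1] with eigenvalue -[E], nonzero at u by [Pun]. *)
have rhoY : Y1^T *m (P^T *m evec n) = Otheta b n 0 *: (P^T *m evec n).
  rewrite mulmxA -trmx_mul -[P *m Y1]opprK -PY linearN /= trmx_mul mulNmx -mulmxA.
  have -> : Y2^T *m evec n = E *: evec n.
    apply: left_eigenvector => // v; rewrite entries_OY // /seqY.
    by rewrite Ophi_last // mul0r addr0.
  by rewrite -scalemxAr Otheta_opp0 // scaleNr opprK.
have [|v [vU vY v0]] := stable_eigenvector stY cpY qY rhoY uU.
  by rewrite mulmxA -[u]trmxK -trmx_mul dot_evec_eq0.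
have eY : Y1 *m v^T = Otheta b n 0 *: v^T by rewrite -[Y1]trmxK -trmx_mul vY linearZ.
have ev := OY_eigen_evec0 eY.
have z0 : entries v^T 0 != 0.
  apply: contra_neq v0 => z0; rewrite -[v]trmxK ev z0 scale0r trmx0 mul0mx.
  by [].
apply: evec0_sub_full.
have -> : evec 0 = (entries v^T 0)^-1 *: v^T :> 'cV[C]_n.+1.
  by rewrite {2}ev scalerA mulVf // scale1r.
by rewrite linearZ /= trmxK scalemx_sub.
Qed.

End Submodule.

End Irreducible.

Section FlipIso.
Variables (R : rcfType) (a b c : complex R) (n : nat).
Local Notation C := (complex R).
Hypothesis n_even : ~~ odd n.
Hypothesis phi_neq0 : forall i, (0 < i <= n)%N -> Ophi a b c n i != 0.
Hypothesis phi'_neq0 : forall i, (0 < i <= n)%N -> Ophi a (- b) (- c) n i != 0.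
Hypothesis theta_inj0 : forall i, (0 < i <= n)%N -> Otheta a n i != Otheta a n 0.
Hypothesis theta'_inj0 : forall i, (0 < i <= n)%N -> Otheta b n i != Otheta b n 0.

Lemma twist_irreducible :
  mx_irreducible3 (OX a b c n) (- OY a b c n) (- OZ a b c n).
Proof.
move=> U stX stY _; case: (eqVneq U 0) => [->|U0]; [by left | right].
apply: (stable_full n_even phi_neq0 phi'_neq0 theta_inj0 theta'_inj0 stX _ U0).
by move: stY; rewrite linearN /= mulmxN eqmx_opp.
Qed.

Lemma twist_iso :
  mx_iso3 (OX a b c n) (- OY a b c n) (- OZ a b c n)
    (OX a (- b) (- c) n) (OY a (- b) (- c) n) (OZ a (- b) (- c) n).
Proof.
have [P [PX PY P0]] := flip_exists n_even phi'_neq0.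
(* The kernel of P is stable under X and Y1. If nonzero it would be everything, against P v_0 having
   first coordinate 1. *)
have uP : P \in unitmx.
  rewrite -unitmx_tr -row_free_unit -kermx_eq0.
  have kX : (kermx P^T *m (OX a b c n)^T <= kermx P^T)%MS.
    by apply/sub_kermxP; rewrite -mulmxA -trmx_mul PX trmx_mul mulmxA mulmx_ker mul0mx.
  have kY : (kermx P^T *m (OY a b c n)^T <= kermx P^T)%MS.
    apply/sub_kermxP; rewrite -mulmxA -trmx_mul -[P *m _]opprK -PY linearN /= trmx_mul.
    by rewrite mulmxN mulmxA mulmx_ker mul0mx oppr0.
  apply/negPn/negP => K0.
  have := stable_full n_even phi_neq0 phi'_neq0 theta_inj0 theta'_inj0 kX kY K0.
  rewrite -sub1mx => /sub_kermxP; rewrite mul1mx => /(congr1 trmx).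
  rewrite trmxK trmx0 => PZ; move: P0; rewrite PZ mul0mx.
  move=> /(congr1 (fun v : 'cV[C]_n.+1 => entries v 0)); rewrite entries_flip_vec //=.
  by move/eqP; rewrite /entries mxE eq_sym oner_eq0.
have X_eq : OX a (- b) (- c) n = OX a b c n by [].
exists P; split=> //; split; first by rewrite X_eq.
split; first by rewrite mulmxN PY.
have PYN : P *m OY a b c n = - (OY a (- b) (- c) n *m P) by rewrite PY opprK.
have e1 : P *m (OX a b c n * OY a b c n) = - (OX a b c n * OY a (- b) (- c) n *m P).
  by rewrite mulmxA PX -mulmxA PYN mulmxN mulmxA.
have e2 : P *m (OY a b c n * OX a b c n) = - (OY a (- b) (- c) n * OX a b c n *m P).
  by rewrite mulmxA PYN mulNmx -mulmxA PX mulmxA.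
rewrite /OZ X_eq mulmxN mulmxBr mulmxDr e1 e2 mulmxBl mulmxDl mul_mx_scalar mul_scalar_mx.
rewrite !opprD !opprK; congr (_ + _).
(* Like the anticommutator, the scalar in Z changes sign with (b, c), so Z is intertwined with the
   right sign. *)
have -> : 2 * a * b - c * n.+1%:R = - (2 * a * - b - - c * n.+1%:R) by ring.
by rewrite scaleNr.
Qed.

End FlipIso.

(** * Nonvanishing of the Dunkl coefficients, the phi_i and the eigenvalue differences *)

Section Nonvanishing.
Variable R : rcfType.
Local Notation C := (complex R).

Lemma cR_natr (m : nat) : m%:R = cR m%:R :> C.
Proof. by rewrite [RHS](rmorph_nat (real_complex R)). Qed.

Lemma cR_natD_neq0 (x : R) (m : nat) : 0 <= x -> (0 < m)%N -> m%:R + cR x != 0.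
Proof.
move=> x0 m0; rewrite cR_natr -cRD; apply/eqP => -[/eqP].
by rewrite gt_eqF // ltr_wpDr // ltr0n.
Qed.

(** The coefficient is j for even j and j + 2x for odd j. If the latter is 0, then 2x = -j is an odd
    negative integer and [lt_t] gives n < j. *)
Lemma dunkl_coef_neq0 (x : R) n j : lt_t n x -> (0 < j <= n)%N -> dunkl_coef x j != 0.
Proof.
move=> tx /andP[j0 jn]; rewrite /dunkl_coef.
case: (sign_odd_cases R j) => -[odd_j ->].
  by rewrite subrr mulr0 addr0 pnatr_eq0 -lt0n.
apply/eqP => e.
have e2 : j%:R + 2 * x = 0.
  have : cR (j%:R + 2 * x) = 0.
    by rewrite mulrDl mul1r !cRD -cR_natr -e; ring.
  by case.
have : n%:R < - (2 * x).
  apply: tx; exists j./2.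
  have -> : j./2.*2.+1 = j by lia.
  by apply/eqP; rewrite -addr_eq0 addrC e2.
by rewrite -(addr0_eq e2) opprK ltr_nat ltnNge jn.
Qed.

Variables (k1 k2 k3 : R) (n : nat).
Hypothesis (k1_ge0 : 0 <= k1) (k2_ge0 : 0 <= k2) (k3_ge0 : 0 <= k3).
Hypothesis n_even : ~~ odd n.
Local Notation h := (n.+1%:R / 2 : C).
Local Notation ka := (cR (k2 + k3) + h).
Local Notation kb := (- cR (k1 + k3) - h).
Local Notation kc := (- cR (k1 + k2) - h).

(** With these parameters phi_i factors into positive reals: i (n+1-i+2 k1) for even i and
    (n+1-i)(i+2 k2) for odd i. *)
Lemma Ophi_nonneg_neq0 i : (0 < i <= n)%N -> Ophi ka kb kc n i != 0.
Proof.
move=> /andP[i0 le]; rewrite /Ophi.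
have ni : (n.+1 - i)%:R = n.+1%:R - i%:R :> C by rewrite natrB // ltnW.
case: ifP => _.
  have -> : i%:R * (n%:R + 1 - 2 * i%:R - 2 * ka - 2 * kb - 2 * kc) / 2 =
      i%:R * ((n.+1 - i)%:R + cR (k1 + k1)) :> C.
    by rewrite ni !cRD; field.
  by rewrite mulf_neq0 ?pnatr_eq0 -?lt0n // cR_natD_neq0 ?addr_ge0 ?subn_gt0.
have -> : (i%:R - n%:R - 1) * (n%:R + 1 - 2 * i%:R - 2 * ka - 2 * kb + 2 * kc) / 2 =
    (n.+1 - i)%:R * (i%:R + cR (k2 + k2)) :> C.
  by rewrite ni !cRD; field.
by rewrite mulf_neq0 ?pnatr_eq0 ?subn_eq0 -?ltnNge // cR_natD_neq0 ?addr_ge0.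
Qed.

Lemma Ophi_opp_nonneg_neq0 i : (0 < i <= n)%N -> Ophi ka (- kb) (- kc) n i != 0.
Proof.
move=> /andP[i0 le]; rewrite /Ophi.
have ni : (n.+1 - i)%:R = n.+1%:R - i%:R :> C by rewrite natrB // ltnW.
case: ifP => _.
  have -> : i%:R * (n%:R + 1 - 2 * i%:R - 2 * ka - 2 * - kb - 2 * - kc) / 2 =
      - (i%:R * ((n.+1 + i)%:R + cR ((k1 + k1) + (k2 + k2) + (k3 + k3)))) :> C.
    by rewrite !cRD; field.
  rewrite oppr_eq0 mulf_neq0 ?pnatr_eq0 -?lt0n // cR_natD_neq0 ?addn_gt0 //.
  by rewrite !addr_ge0.
have -> : (i%:R - n%:R - 1) * (n%:R + 1 - 2 * i%:R - 2 * ka - 2 * - kb + 2 * - kc) / 2 =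
    (n.+1 - i)%:R * (i%:R + cR (k3 + k3)) :> C.
  by rewrite ni !cRD; field.
by rewrite mulf_neq0 ?pnatr_eq0 ?subn_eq0 -?ltnNge // cR_natD_neq0 ?addr_ge0.
Qed.

Lemma Otheta_a_inj0 i : (0 < i <= n)%N -> Otheta ka n i != Otheta ka n 0.
Proof.
move=> /andP[i0 le]; rewrite -subr_eq0 /Otheta expr0.
case: (sign_odd_cases R i) => -[_ ->].
  have -> : 1 * ((2 * ka - n%:R + 2 * i%:R) / 2) - 1 * ((2 * ka - n%:R + 2 * 0) / 2)
    = i%:R by field.
  by rewrite pnatr_eq0 -lt0n.
have -> : -1 * ((2 * ka - n%:R + 2 * i%:R) / 2) - 1 * ((2 * ka - n%:R + 2 * 0) / 2)
    = - (i.+1%:R + cR ((k2 + k3) + (k2 + k3))) by rewrite !cRD; field.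
by rewrite oppr_eq0 cR_natD_neq0 ?addr_ge0.
Qed.

(** The difference is i for even i, and 2n+1-i+2(k1+k3) for odd i, positive because i is at most
    n. *)
Lemma Otheta_b_inj0 i : (0 < i <= n)%N -> Otheta kb n i != Otheta kb n 0.
Proof.
move=> /andP[i0 le]; rewrite -subr_eq0 /Otheta expr0.
case: (sign_odd_cases R i) => -[_ ->].
  have -> : 1 * ((2 * kb - n%:R + 2 * i%:R) / 2) - 1 * ((2 * kb - n%:R + 2 * 0) / 2)
    = i%:R by field.
  by rewrite pnatr_eq0 -lt0n.
have ni : (n.+1 + n - i)%:R = (n.+1 + n)%:R - i%:R :> C.
  by rewrite natrB // (leq_trans (leqW le)) // leq_addr.
have -> : -1 * ((2 * kb - n%:R + 2 * i%:R) / 2) - 1 * ((2 * kb - n%:R + 2 * 0) / 2)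
    = (n.+1 + n - i)%:R + cR ((k1 + k3) + (k1 + k3)) by rewrite ni !cRD; field.
by rewrite cR_natD_neq0 ?addr_ge0 // subn_gt0 (leq_trans _ (leq_addr _ _)) // ltnS.
Qed.

End Nonvanishing.

(** * The decomposition of M_n and the irreducible case *)

Theorem theorem6p6 (R : rcfType) (k1 k2 k3 : R) (n : nat) :
  ~~ odd n -> lt_t n k1 -> lt_t n k2 -> lt_t n k3 ->
  let k := kvec k1 k2 k3 in
  let h : complex R := (n.+1)%:R / 2 in
  (* W = O_n(a,b,c)^(1,-1) *)
  let a := cR (k2 + k3) + h in
  let b := - cR (k1 + k3) - h in
  let c := - cR (k1 + k2) - h in
  let WX := OX a b c n in
  let WY := - OY a b c n in
  let WZ := - OZ a b c n in
  (exists psi : {linear dsum_space R n -> spin R},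
      injective psi /\
      (forall v, Mspace k n v <-> exists w, v = psi w) /\
      (forall w, BIX k (psi w) = psi (dsum_act WX w) /\
                 BIY k (psi w) = psi (dsum_act WY w) /\
                 BIZ k (psi w) = psi (dsum_act WZ w)))
  /\
  (0 <= k1 -> 0 <= k2 -> 0 <= k3 ->
     mx_irreducible3 WX WY WZ /\
     let a' := cR (k2 + k3) + h in
     let b' := cR (k1 + k3) + h in
     let c' := cR (k1 + k2) + h in
     mx_iso3 WX WY WZ (OX a' b' c' n) (OY a' b' c' n) (OZ a' b' c' n)).
Proof.
move=> n_even t1 t2 t3 k h a b c WX WY WZ; split.
  have nz i j : (0 < j <= n)%N -> dunkl_coef (k i) j != 0.
    by apply: dunkl_coef_neq0; case: i => -[|[|[|]]].
  pose lin := GRing.isLinear.Build (complex R) (dsum_space R n) (spin R) *:%R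
    (@slice_embed R k n) (@slice_embed_linear R k n).
  pose psi : {linear dsum_space R n -> spin R} := HB.pack (@slice_embed R k n) lin.
  exists psi; split; first exact: slice_embed_inj.
  split.
    move=> v; split; first exact: slice_embed_surj.
    by move=> [w ->]; exact: slice_embed_Mspace.
  move=> w; split; first exact: (slice_embed_BIX n_even nz).
  by split; [exact: (slice_embed_BIY n_even nz) | exact: (slice_embed_BIZ n_even nz)].
move=> k1_ge0 k2_ge0 k3_ge0; split.
  apply: twist_irreducible n_even _ _ _ _.
  - exact: Ophi_nonneg_neq0.
  - exact: Ophi_opp_nonneg_neq0.
  - exact: Otheta_a_inj0.
  - exact: Otheta_b_inj0.
move=> a' b' c'; have -> : b' = - b by rewrite opprD !opprK.
have -> : c' = - c by rewrite opprD !opprK.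
apply: twist_iso n_even _ _ _ _.
- exact: Ophi_nonneg_neq0.
- exact: Ophi_opp_nonneg_neq0.
- exact: Otheta_a_inj0.
- exact: Otheta_b_inj0.
Qed.
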